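(* Let $k$ be an algebraically closed field of characteristic $0$, let $a,b$ be algebraically independent over $k$, and put $u=ab$, $v=b^3$. Let $i_1,i_2,i_3\in k(u,v)$ be the absolute invariants of the genus 2 field $Y^2=(X^3+aX^2+bX+1)(4X^3+b^2X^2+2bX+1)$, and let $$r_1=\frac{v(v-9-2u)^3}{27\,(4v^2-18uv+27v-u^2v+4u^3)},\qquad r_2=-\frac{v(v-9-2u)^4}{1296\,(v-27)(4v^2-18uv+27v-u^2v+4u^3)} .$$ Then the subfields $k(i_1,i_2,i_3)$ and $k(r_1,r_2)$ of $k(u,v)$ coincide, hence $[k(u,v):k(i_1,i_2,i_3)]=2$. Moreover, $$i_1=\frac94\cdot\frac{13824r_1^3r_2^2+442368r_1^2r_2^3+5308416r_1r_2^4+192r_1^4r_2+r_1^5+786432r_1r_2^3+9437184r_2^4}{r_1(-1152r_2^2+96r_2r_1+r_1^2)^2},$$ $$i_2=\frac{27\,P}{8\,r_1^2(-1152r_2^2+96r_2r_1+r_1^2)^3},$$ where $$\begin{aligned}P={}&79626240r_1^4r_2^4-4076863488r_1^2r_2^5+34560r_1^6r_2^2+12230590464r_1^2r_2^6+32614907904r_1r_2^6\\&+14495514624r_2^6+288r_1^7r_2+2211840r_1^5r_2^3+r_1^8-212336640r_1^3r_2^4+1528823808r_1^3r_2^5-2359296r_1^4r_2^3,\end{aligned}$$ and $$i_3=-521838526464\,\frac{r_2^9}{r_1^2(-1152r_2^2+96r_2r_1+r_1^2)^5}.$$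
   Context: For a genus 2 curve $Y^2=f(X,1)$, with $f(X,Z)=a_6X^6+a_5X^5Z+\dots+a_0Z^6$ a binary sextic without multiple factors, the classical invariants $J_2,J_4,J_6,J_{10}$ are the Igusa–Clebsch invariants: polynomials in the $a_i$ which for $a_6\neq0$ and roots $x_1,\dots,x_6$ of $f(X,1)$, with $(ij)=x_i-x_j$, are $J_2=a_6^2\sum_{15}(12)^2(34)^2(56)^2$, $J_4=a_6^4\sum_{10}(12)^2(23)^2(31)^2(45)^2(56)^2(64)^2$, $J_6=a_6^6\sum_{60}(12)^2(23)^2(31)^2(45)^2(56)^2(64)^2(14)^2(25)^2(36)^2$, $J_{10}=a_6^{10}\prod_{i<j}(ij)^2$, each sum running over all distinct expressions obtained by permuting the indices. The absolute invariants (for $J_2\ne0$) are $$i_1=144\frac{J_4}{J_2^2},\quad i_2=-1728\frac{J_2J_4-3J_6}{J_2^3},\quad i_3=486\frac{J_{10}}{J_2^5}.$$ *)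

(* Defs.v *)
From HB Require Import structures.
From mathcomp Require Export all_boot all_order all_algebra.
From mathcomp Require Export boolp classical_sets.

Set Implicit Arguments.
Unset Strict Implicit.
Unset Printing Implicit Defensive.

Import GRing.Theory.
Local Open Scope ring_scope.

Section Invariants.
Variable K : closedFieldType.

(* The six indices are 0, ..., 5.  A product of distinct factors (ij)^2, with
   (ij) = x_i - x_j, is encoded by the list of its index pairs. *)
Definition index_pairs : seq (nat * nat) :=
  [seq (i, j) | i <- iota 0 6, j <- iota i.+1 (5 - i)].

(* As (ij)^2 = (ji)^2, the result is normalised to a subsequence of
   index_pairs, so that equal expressions have equal encodings. *)
Definition permute_indices (s : seq nat) (g : seq (nat * nat)) :
    seq (nat * nat) :=
  let s_ := nth 0%N s in
  [seq e <- index_pairs | has (fun d =>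
     (e == (s_ d.1, s_ d.2)) || (e == (s_ d.2, s_ d.1))) g].

Definition distinct_expressions (g : seq (nat * nat)) :
    seq (seq (nat * nat)) :=
  undup [seq permute_indices s g | s <- permutations (iota 0 6)].

Definition square_diffs (x : seq K) (g : seq (nat * nat)) : K :=
  \prod_(e <- g) (x`_(e.1) - x`_(e.2)) ^+ 2.

Definition expression_sum (x : seq K) (g : seq (nat * nat)) : K :=
  \sum_(h <- distinct_expressions g) square_diffs x h.

Definition poly_roots (f : {poly K}) : seq K :=
  sval (closed_field_poly_normal f).

(* Igusa-Clebsch invariants of Y^2 = f(X), where f has degree exactly 6, so
   that f`_6 is its leading coefficient and poly_roots f has six entries.
   They do not depend on the order of the roots. *)
Definition igusa_clebsch_J2 (f : {poly K}) : K :=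
  f`_6 ^+ 2 * expression_sum (poly_roots f) [:: (0, 1); (2, 3); (4, 5)]%N.

Definition igusa_clebsch_J4 (f : {poly K}) : K :=
  f`_6 ^+ 4 * expression_sum (poly_roots f)
    [:: (0, 1); (1, 2); (2, 0); (3, 4); (4, 5); (5, 3)]%N.

Definition igusa_clebsch_J6 (f : {poly K}) : K :=
  f`_6 ^+ 6 * expression_sum (poly_roots f)
    [:: (0, 1); (1, 2); (2, 0); (3, 4); (4, 5); (5, 3);
        (0, 3); (1, 4); (2, 5)]%N.

Definition igusa_clebsch_J10 (f : {poly K}) : K :=
  f`_6 ^+ 10 * square_diffs (poly_roots f) index_pairs.

(* Only meaningful when igusa_clebsch_J2 f != 0. *)
Definition absolute_i1 (f : {poly K}) : K :=
  144 * (igusa_clebsch_J4 f / igusa_clebsch_J2 f ^+ 2).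

Definition absolute_i2 (f : {poly K}) : K :=
  - 1728 * ((igusa_clebsch_J2 f * igusa_clebsch_J4 f
             - 3 * igusa_clebsch_J6 f) / igusa_clebsch_J2 f ^+ 3).

Definition absolute_i3 (f : {poly K}) : K :=
  486 * (igusa_clebsch_J10 f / igusa_clebsch_J2 f ^+ 5).

End Invariants.

Section Subfields.
Local Open Scope classical_set_scope.

Definition is_subfield (K : fieldType) (A : set K) : Prop :=
  [/\ A 1,
      (forall x y, A x -> A y -> A (x - y)) &
      (forall x y, A x -> A y -> A (x / y))].

(* The subfield k(S) of K, k being seen inside K through phi. *)
Definition adjoin_field (k K : fieldType) (phi : {rmorphism k -> K})
    (S : set K) : set K :=
  smallest (@is_subfield K) (range phi `|` S).

(* [E : F] = n for subfields F, E of K: E has an F-basis of n elements. *)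
Definition has_degree (K : fieldType) (F E : set K) (n : nat) : Prop :=
  F `<=` E /\
  exists e : 'I_n -> K,
    [/\ (forall i, E (e i)),
        (forall x, E x -> exists c : 'I_n -> K,
            (forall i, F (c i)) /\ x = \sum_(i < n) c i * e i) &
        (forall c : 'I_n -> K, (forall i, F (c i)) ->
            \sum_(i < n) c i * e i = 0 -> forall i, c i = 0)].

Definition alg_independent2 (k K : fieldType) (phi : {rmorphism k -> K})
    (a b : K) : Prop :=
  forall p : {poly {poly k}},
    (map_poly (map_poly phi) p).[a, b] = 0 -> p = 0.

End Subfields.

(* Main.v *)
From HB Require Import structures.
Require Import Defs.
From mathcomp Require Import mxpoly ring zify.

Set Implicit Arguments.
Unset Strict Implicit.
Unset Printing Implicit Defensive.

Import GRing.Theory.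
Local Open Scope classical_set_scope.
Local Open Scope ring_scope.

(** Why the theorem is true.

    Put m = v - 9 - 2u, n = v - 27, p = m - n = 18 - 2u and
    D = 4a^3 + 4b^3 - a^2 b^2 - 18ab + 27.  Then the factor
    d = 4v^2 - 18uv + 27v - u^2 v + 4u^3 of the denominators of r_1 and r_2
    equals v D, the two cubic factors have discriminants - D and 16 n, and
    their resultant is - D.  The Igusa-Clebsch invariants are forms in m, p, D
    of weights 1, 1, 3: J_2 = 6 m^2 - 4 p^2, while 4 J_4 and 8 J_6 are [form4]
    and [form6] below and J_10 = - 16 n D^3.  Also r_1 = m^3 / (27 D) and
    r_2 = - m^4 / (1296 n D).  Hence everything lives in the field generated
    by the two ratios c = n / p and y = D / p^3: this field is k(r_1, r_2), it
    contains i_1, i_2, i_3, and the three displayed formulas are identities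
    between rational functions.

    That k(i_1, i_2, i_3) contains z = m / p = c + 1, and therefore y, is the
    elimination step.  The value of J_4 / J_2^2 expresses y rationally in z,
    and substituting this in the values of J_10 / J_2^5 and J_6 / J_2^3 gives
    two polynomials over k(i_1, i_2, i_3), of degrees 13 and 8, with the common
    root z ([elim1] and [elim2]).  If their quotients by X - z are coprime,
    then their greatest common divisor is linear; as it can be computed over
    k(i_1, i_2, i_3), its root z lies there ([subfield_common_root]).  In
    homogeneous form all coefficients are polynomials in a and b, so it is
    enough to find one point (a, b) where the quotients are coprime
    ([coprimep_lift], through the resultant).  At (2, 3) one has n = 0, hence
    J_10 = 0, and the first quotient becomes the cube of a quartic, which
    makes the verification short ([ratio_mem_subfield]).

    For the degree, u = 9 - p / 2 and v = 27 + c p, and the equation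
    d = y p^3 v has become quadratic in p over k(c, y)
    ([slope_relation]).  So k(u, v) = k(c, y)(p) has degree at most 2
    ([has_degree2]).  It is not 1, because the other root p' of the quadratic
    gives a second point (u', v') where r_1 and r_2 take the same values: the
    rational functions with equal values at the two points form a field which
    contains k(r_1, r_2), but not p, as p' differs from p ([p_not_mem]).

    Every non-vanishing statement comes from the algebraic independence of a
    and b: a polynomial in a, b is nonzero when its value at one well chosen
    point is ([eval2_neq0]). *)

(** * Igusa-Clebsch invariants as polynomials in the coefficients *)

(** The invariants J_2, J_4, J_6 of a_6 X^6 + ... + a_0, with the normalisation
    of their definition by the roots. *)
Definition sextic_J2 (R : comNzRingType) (a0 a1 a2 a3 a4 a5 a6 : R) : R :=
  6 * a3 ^+ 2 - 16 * a2 * a4 + 40 * a1 * a5 - 240 * a0 * a6.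

Definition sextic_J4 (R : comNzRingType) (a0 a1 a2 a3 a4 a5 a6 : R) : R :=
  4 * a2 ^+ 2 * a4 ^+ 2 - 12 * a2 ^+ 2 * a3 * a5
    + 48 * a2 ^+ 3 * a6 - 12 * a1 * a3 * a4 ^+ 2
    + 36 * a1 * a3 ^+ 2 * a5 + 4 * a1 * a2 * a4 * a5
    - 180 * a1 * a2 * a3 * a6 - 80 * a1 ^+ 2 * a5 ^+ 2
    + 300 * a1 ^+ 2 * a4 * a6 + 48 * a0 * a4 ^+ 3
    - 180 * a0 * a3 * a4 * a5 + 324 * a0 * a3 ^+ 2 * a6
    + 300 * a0 * a2 * a5 ^+ 2 - 504 * a0 * a2 * a4 * a6
    - 540 * a0 * a1 * a5 * a6 + 1620%:R * a0 ^+ 2 * a6 ^+ 2.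

Definition sextic_J6 (R : comNzRingType) (a0 a1 a2 a3 a4 a5 a6 : R) : R :=
  8 * a2 ^+ 2 * a3 ^+ 2 * a4 ^+ 2 - 24 * a2 ^+ 2 * a3 ^+ 3 * a5
    - 24 * a2 ^+ 3 * a4 ^+ 3 + 76 * a2 ^+ 3 * a3 * a4 * a5
    + 60 * a2 ^+ 3 * a3 ^+ 2 * a6 - 36 * a2 ^+ 4 * a5 ^+ 2
    - 160 * a2 ^+ 4 * a4 * a6 - 24 * a1 * a3 ^+ 3 * a4 ^+ 2
    + 72 * a1 * a3 ^+ 4 * a5 + 76 * a1 * a2 * a3 * a4 ^+ 3
    - 238 * a1 * a2 * a3 ^+ 2 * a4 * a5
    - 198 * a1 * a2 * a3 ^+ 3 * a6
    + 28 * a1 * a2 ^+ 2 * a4 ^+ 2 * a5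
    + 26 * a1 * a2 ^+ 2 * a3 * a5 ^+ 2
    + 492 * a1 * a2 ^+ 2 * a3 * a4 * a6
    + 616 * a1 * a2 ^+ 3 * a5 * a6 - 36 * a1 ^+ 2 * a4 ^+ 4
    + 26 * a1 ^+ 2 * a3 * a4 ^+ 2 * a5
    + 176 * a1 ^+ 2 * a3 ^+ 2 * a5 ^+ 2
    + 330 * a1 ^+ 2 * a3 ^+ 2 * a4 * a6
    + 64 * a1 ^+ 2 * a2 * a4 * a5 ^+ 2
    - 640 * a1 ^+ 2 * a2 * a4 ^+ 2 * a6
    - 1860%:R * a1 ^+ 2 * a2 * a3 * a5 * a6
    - 900 * a1 ^+ 2 * a2 ^+ 2 * a6 ^+ 2 - 320 * a1 ^+ 3 * a5 ^+ 3
    + 1600%:R * a1 ^+ 3 * a4 * a5 * a6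
    + 2250%:R * a1 ^+ 3 * a3 * a6 ^+ 2 + 60 * a0 * a3 ^+ 2 * a4 ^+ 3
    - 198 * a0 * a3 ^+ 3 * a4 * a5 + 162 * a0 * a3 ^+ 4 * a6
    - 160 * a0 * a2 * a4 ^+ 4
    + 492 * a0 * a2 * a3 * a4 ^+ 2 * a5
    + 330 * a0 * a2 * a3 ^+ 2 * a5 ^+ 2
    - 468 * a0 * a2 * a3 ^+ 2 * a4 * a6
    - 640 * a0 * a2 ^+ 2 * a4 * a5 ^+ 2
    + 424 * a0 * a2 ^+ 2 * a4 ^+ 2 * a6
    - 876 * a0 * a2 ^+ 2 * a3 * a5 * a6
    - 96 * a0 * a2 ^+ 3 * a6 ^+ 2
    + 616 * a0 * a1 * a4 ^+ 3 * a5
    - 1860%:R * a0 * a1 * a3 * a4 * a5 ^+ 2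
    - 876 * a0 * a1 * a3 * a4 ^+ 2 * a6
    + 1818%:R * a0 * a1 * a3 ^+ 2 * a5 * a6
    + 1600%:R * a0 * a1 * a2 * a5 ^+ 3
    + 3472%:R * a0 * a1 * a2 * a4 * a5 * a6
    + 3060%:R * a0 * a1 * a2 * a3 * a6 ^+ 2
    - 2240%:R * a0 * a1 ^+ 2 * a5 ^+ 2 * a6
    - 18600%:R * a0 * a1 ^+ 2 * a4 * a6 ^+ 2
    - 900 * a0 ^+ 2 * a4 ^+ 2 * a5 ^+ 2
    - 96 * a0 ^+ 2 * a4 ^+ 3 * a6 + 2250%:R * a0 ^+ 2 * a3 * a5 ^+ 3
    + 3060%:R * a0 ^+ 2 * a3 * a4 * a5 * a6
    - 10044%:R * a0 ^+ 2 * a3 ^+ 2 * a6 ^+ 2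
    - 18600%:R * a0 ^+ 2 * a2 * a5 ^+ 2 * a6
    + 20664%:R * a0 ^+ 2 * a2 * a4 * a6 ^+ 2
    + 59940%:R * a0 ^+ 2 * a1 * a5 * a6 ^+ 2
    - 119880%:R * a0 ^+ 3 * a6 ^+ 3.

Lemma coef_prod6_XsubC (R : comNzRingType) (x0 x1 x2 x3 x4 x5 : R) (i : nat) :
  (\prod_(z <- [:: x0; x1; x2; x3; x4; x5]) ('X - z%:P))`_i = nth 0 [::
    (x0 * x1 * x2 * x3 * x4 * x5);
    - (x0 * x1 * x2 * x3 * x4 + x0 * x1 * x2 * x3 * x5
         + x0 * x1 * x2 * x4 * x5 + x0 * x1 * x3 * x4 * x5
         + x0 * x2 * x3 * x4 * x5 + x1 * x2 * x3 * x4 * x5);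
    (x0 * x1 * x2 * x3 + x0 * x1 * x2 * x4 + x0 * x1 * x2 * x5
         + x0 * x1 * x3 * x4 + x0 * x1 * x3 * x5 + x0 * x1 * x4 * x5
         + x0 * x2 * x3 * x4 + x0 * x2 * x3 * x5 + x0 * x2 * x4 * x5
         + x0 * x3 * x4 * x5 + x1 * x2 * x3 * x4 + x1 * x2 * x3 * x5
         + x1 * x2 * x4 * x5 + x1 * x3 * x4 * x5 + x2 * x3 * x4 * x5);
    - (x0 * x1 * x2 + x0 * x1 * x3 + x0 * x1 * x4 + x0 * x1 * x5
         + x0 * x2 * x3 + x0 * x2 * x4 + x0 * x2 * x5 + x0 * x3 * x4
         + x0 * x3 * x5 + x0 * x4 * x5 + x1 * x2 * x3 + x1 * x2 * x4
         + x1 * x2 * x5 + x1 * x3 * x4 + x1 * x3 * x5 + x1 * x4 * x5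
         + x2 * x3 * x4 + x2 * x3 * x5 + x2 * x4 * x5 + x3 * x4 * x5);
    (x0 * x1 + x0 * x2 + x0 * x3 + x0 * x4 + x0 * x5 + x1 * x2 + x1 * x3
         + x1 * x4 + x1 * x5 + x2 * x3 + x2 * x4 + x2 * x5 + x3 * x4
         + x3 * x5 + x4 * x5);
    - (x0 + x1 + x2 + x3 + x4 + x5);
    1] i.
Proof.
rewrite -[RHS]coef_Poly; congr (nth _ (polyseq _) _).
by rewrite unlock /= !cons_poly_def; ring.
Qed.

Ltac rewrite_viete x0 x1 x2 x3 x4 x5 :=
  let cf := constr:(coef_prod6_XsubC x0 x1 x2 x3 x4 x5) in
  have /= -> := cf 0%N; have /= -> := cf 1%N; have /= -> := cf 2%N;
  have /= -> := cf 3%N; have /= -> := cf 4%N; have /= -> := cf 5%N;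
  have /= -> := cf 6%N.

Section SplitSums.
Variable R : comNzRingType.

Definition triangle (x y z : R) : R :=
  (x - y) ^+ 2 * (x - z) ^+ 2 * (y - z) ^+ 2.

Definition split_J4 (x y z u v w : R) : R := triangle x y z * triangle u v w.

(** The last factor runs over the six matchings between the two triples; the
    ten splits thus account for the sixty expressions of J_6. *)
Definition split_J6 (x y z u v w : R) : R :=
  triangle x y z * triangle u v w *
  ((x - u) ^+ 2 * (y - v) ^+ 2 * (z - w) ^+ 2
   + (x - u) ^+ 2 * (y - w) ^+ 2 * (z - v) ^+ 2
   + (x - v) ^+ 2 * (y - u) ^+ 2 * (z - w) ^+ 2
   + (x - v) ^+ 2 * (y - w) ^+ 2 * (z - u) ^+ 2
   + (x - w) ^+ 2 * (y - u) ^+ 2 * (z - v) ^+ 2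
   + (x - w) ^+ 2 * (y - v) ^+ 2 * (z - u) ^+ 2).

(** The ten ways to split six roots into two triples. *)
Definition sum_over_splits (E : R -> R -> R -> R -> R -> R -> R)
    (x0 x1 x2 x3 x4 x5 : R) : R :=
  E x0 x1 x2 x3 x4 x5 + E x0 x1 x3 x2 x4 x5 + E x0 x1 x4 x2 x3 x5
  + E x0 x1 x5 x2 x3 x4 + E x0 x2 x3 x1 x4 x5 + E x0 x2 x4 x1 x3 x5
  + E x0 x2 x5 x1 x3 x4 + E x0 x3 x4 x1 x2 x5 + E x0 x3 x5 x1 x2 x4
  + E x0 x4 x5 x1 x2 x3.

Lemma sum_split_J4 (x0 x1 x2 x3 x4 x5 : R) :
  let f := \prod_(z <- [:: x0; x1; x2; x3; x4; x5]) ('X - z%:P) in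
  sum_over_splits split_J4 x0 x1 x2 x3 x4 x5 =
  sextic_J4 f`_0 f`_1 f`_2 f`_3 f`_4 f`_5 f`_6.
Proof.
move=> f.
rewrite_viete x0 x1 x2 x3 x4 x5.
cbv beta delta [sum_over_splits split_J4 triangle sextic_J4].
ring.
Qed.

(** Invariance under X -> X + t, which allows placing a root at 0. *)
Lemma sextic_J6_translate (a0 a1 a2 a3 a4 a5 a6 t : R) :
  sextic_J6
    (a0 + a1 * t + a2 * t ^+ 2 + a3 * t ^+ 3
     + a4 * t ^+ 4 + a5 * t ^+ 5 + a6 * t ^+ 6)
    (a1 + 2 * a2 * t + 3 * a3 * t ^+ 2 + 4 * a4 * t ^+ 3
     + 5 * a5 * t ^+ 4 + 6 * a6 * t ^+ 5)
    (a2 + 3 * a3 * t + 6 * a4 * t ^+ 2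
     + 10 * a5 * t ^+ 3 + 15 * a6 * t ^+ 4)
    (a3 + 4 * a4 * t + 10 * a5 * t ^+ 2 + 20 * a6 * t ^+ 3)
    (a4 + 5 * a5 * t + 15 * a6 * t ^+ 2)
    (a5 + 6 * a6 * t)
    a6 =
  sextic_J6 a0 a1 a2 a3 a4 a5 a6.
Proof. cbv beta delta [sextic_J6]; ring. Qed.

Lemma sum_split_J6_root0 (x0 x1 x2 x3 x4 : R) :
  let f := \prod_(z <- [:: x0; x1; x2; x3; x4; 0]) ('X - z%:P) in
  sum_over_splits split_J6 x0 x1 x2 x3 x4 0 =
  sextic_J6 f`_0 f`_1 f`_2 f`_3 f`_4 f`_5 f`_6.
Proof.
move=> f.
rewrite_viete x0 x1 x2 x3 x4 (0 : R).
cbv beta delta [sum_over_splits split_J6 triangle sextic_J6].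
ring.
Qed.

Lemma sum_split_J6 (x0 x1 x2 x3 x4 x5 : R) :
  let f := \prod_(z <- [:: x0; x1; x2; x3; x4; x5]) ('X - z%:P) in
  sum_over_splits split_J6 x0 x1 x2 x3 x4 x5 =
  sextic_J6 f`_0 f`_1 f`_2 f`_3 f`_4 f`_5 f`_6.
Proof.
move=> f.
have diffE x y : (x - x5) - (y - x5) = x - y by ring.
transitivity (sum_over_splits split_J6
  (x0 - x5) (x1 - x5) (x2 - x5) (x3 - x5) (x4 - x5) 0).
  by rewrite /sum_over_splits /split_J6 /triangle !(diffE, subr0, sub0r, opprB).
rewrite sum_split_J6_root0 -(sextic_J6_translate f`_0 _ _ _ _ _ _ x5).
set g := \prod_(z <- _) _.
have cg : forall i, g`_i = _ :=
  coef_prod6_XsubC (x0 - x5) (x1 - x5) (x2 - x5) (x3 - x5) (x4 - x5) 0.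
rewrite_viete x0 x1 x2 x3 x4 x5.
move: (cg 0%N) (cg 1%N) (cg 2%N) (cg 3%N) (cg 4%N) (cg 5%N) (cg 6%N).
move: g`_0 g`_1 g`_2 g`_3 g`_4 g`_5 g`_6.
move=> b0 b1 b2 b3 b4 b5 b6 -> -> -> -> -> -> ->.
by f_equal; rewrite /=; ring.
Qed.

End SplitSums.

Section ExpressionSums.
Variables (K : closedFieldType) (x0 x1 x2 x3 x4 x5 : K).
Let s := [:: x0; x1; x2; x3; x4; x5].

Local Ltac expand_sum g :=
  let l := eval vm_compute in (distinct_expressions g) in
  have -> : distinct_expressions g = l;
    [by vm_compute | rewrite /square_diffs unlock /=].

(* A permuted product only involves the fifteen squares below: an identity
   that is linear in the products needs no expansion of them. *)
Local Ltac square_atoms :=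
  move: ((x0 - x1) ^+ 2) ((x0 - x2) ^+ 2) ((x0 - x3) ^+ 2) ((x0 - x4) ^+ 2)
    ((x0 - x5) ^+ 2) ((x1 - x2) ^+ 2) ((x1 - x3) ^+ 2) ((x1 - x4) ^+ 2)
    ((x1 - x5) ^+ 2) ((x2 - x3) ^+ 2) ((x2 - x4) ^+ 2) ((x2 - x5) ^+ 2)
    ((x3 - x4) ^+ 2) ((x3 - x5) ^+ 2) ((x4 - x5) ^+ 2) => *.

Lemma expression_sum_J2 :
  let f := \prod_(z <- s) ('X - z%:P) in
  expression_sum s [:: (0, 1); (2, 3); (4, 5)]%N =
  sextic_J2 f`_0 f`_1 f`_2 f`_3 f`_4 f`_5 f`_6.
Proof.
move=> f; rewrite /expression_sum; expand_sum [:: (0, 1); (2, 3); (4, 5)]%N.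
rewrite_viete x0 x1 x2 x3 x4 x5.
by rewrite /sextic_J2; ring.
Qed.

Lemma expression_sum_J4 :
  expression_sum s [:: (0, 1); (1, 2); (2, 0); (3, 4); (4, 5); (5, 3)]%N =
  sum_over_splits (@split_J4 K) x0 x1 x2 x3 x4 x5.
Proof.
rewrite /expression_sum.
expand_sum [:: (0, 1); (1, 2); (2, 0); (3, 4); (4, 5); (5, 3)]%N.
by rewrite /sum_over_splits /split_J4 /triangle; square_atoms; ring.
Qed.

Lemma expression_sum_J6 :
  expression_sum s
    [:: (0, 1); (1, 2); (2, 0); (3, 4); (4, 5); (5, 3);
        (0, 3); (1, 4); (2, 5)]%N =
  sum_over_splits (@split_J6 K) x0 x1 x2 x3 x4 x5.
Proof.
rewrite /expression_sum.
expand_sum [:: (0, 1); (1, 2); (2, 0); (3, 4); (4, 5); (5, 3);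
        (0, 3); (1, 4); (2, 5)]%N.
rewrite /sum_over_splits /split_J6 /triangle.
have sqC (x y : K) : (x - y) ^+ 2 = (y - x) ^+ 2 by rewrite -sqrrN opprB.
rewrite !(sqC x2 x1, sqC x3 x1, sqC x4 x1, sqC x5 x1, sqC x3 x2, sqC x4 x2,
          sqC x5 x2, sqC x4 x3, sqC x5 x3, sqC x5 x4).
by square_atoms; ring.
Qed.

End ExpressionSums.

Section SexticInvariants.
Variable K : closedFieldType.
Implicit Type f : {poly K}.

Lemma poly_rootsP f : f = lead_coef f *: \prod_(z <- poly_roots f) ('X - z%:P).
Proof. exact: svalP (closed_field_poly_normal f). Qed.

Lemma poly_roots6 f : size f = 7%N ->
  exists x0 x1 x2 x3 x4 x5, poly_roots f = [:: x0; x1; x2; x3; x4; x5].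
Proof.
move=> f7; have: size (poly_roots f) = 6%N.
  have : size f = (size (poly_roots f)).+1.
    rewrite {1}(poly_rootsP f) size_scale ?size_prod_XsubC //.
    by rewrite lead_coef_eq0 -size_poly_eq0 f7.
  by rewrite f7 => -[].
case: (poly_roots f) => [|x0 [|x1 [|x2 [|x3 [|x4 [|x5 [|? ?]]]]]]] // _.
by exists x0, x1, x2, x3, x4, x5.
Qed.

Lemma coef_poly_roots f i : size f = 7%N ->
  f`_i = f`_6 * (\prod_(z <- poly_roots f) ('X - z%:P))`_i.
Proof. by move=> f7; rewrite {1}(poly_rootsP f) coefZ lead_coefE f7. Qed.

Lemma igusa_clebsch_J2E f : size f = 7%N ->
  igusa_clebsch_J2 f = sextic_J2 f`_0 f`_1 f`_2 f`_3 f`_4 f`_5 f`_6.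
Proof.
move=> f7; rewrite /igusa_clebsch_J2; have cf i := coef_poly_roots i f7.
rewrite (cf 0%N) (cf 1%N) (cf 2%N) (cf 3%N) (cf 4%N) (cf 5%N).
have [x0 [x1 [x2 [x3 [x4 [x5 ->]]]]]] := poly_roots6 f7.
rewrite expression_sum_J2; have /= -> := coef_prod6_XsubC x0 x1 x2 x3 x4 x5 6.
by cbv beta delta [sextic_J2]; ring.
Qed.

Lemma igusa_clebsch_J4E f : size f = 7%N ->
  igusa_clebsch_J4 f = sextic_J4 f`_0 f`_1 f`_2 f`_3 f`_4 f`_5 f`_6.
Proof.
move=> f7; rewrite /igusa_clebsch_J4; have cf i := coef_poly_roots i f7.
rewrite (cf 0%N) (cf 1%N) (cf 2%N) (cf 3%N) (cf 4%N) (cf 5%N).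
have [x0 [x1 [x2 [x3 [x4 [x5 ->]]]]]] := poly_roots6 f7.
rewrite expression_sum_J4 sum_split_J4.
have /= -> := coef_prod6_XsubC x0 x1 x2 x3 x4 x5 6.
by cbv beta delta [sextic_J4]; ring.
Qed.

Lemma igusa_clebsch_J6E f : size f = 7%N ->
  igusa_clebsch_J6 f = sextic_J6 f`_0 f`_1 f`_2 f`_3 f`_4 f`_5 f`_6.
Proof.
move=> f7; rewrite /igusa_clebsch_J6; have cf i := coef_poly_roots i f7.
rewrite (cf 0%N) (cf 1%N) (cf 2%N) (cf 3%N) (cf 4%N) (cf 5%N).
have [x0 [x1 [x2 [x3 [x4 [x5 ->]]]]]] := poly_roots6 f7.
rewrite expression_sum_J6 sum_split_J6.
have /= -> := coef_prod6_XsubC x0 x1 x2 x3 x4 x5 6.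
by cbv beta delta [sextic_J6]; ring.
Qed.

(** The right-hand side is a product over the roots, which makes the
    discriminant visibly independent of their order.  The sign is that of the
    fifteen transposed differences. *)
Lemma square_diffs_deriv (x0 x1 x2 x3 x4 x5 : K) :
  let s := [:: x0; x1; x2; x3; x4; x5] in
  square_diffs s index_pairs =
  - \prod_(z <- s) (\prod_(y <- s) ('X - y%:P))^`().[z].
Proof.
move=> s; set P := \prod_(y <- s) ('X - y%:P).
have dP z (Q : {poly K}) : P = ('X - z%:P) * Q -> P^`().[z] = Q.[z].
  by move=> ->; rewrite derivM derivXsubC !hornerE subrr mul0r addr0.
rewrite /square_diffs.
have -> : index_pairs =
    ltac:(let l := eval vm_compute in index_pairs in exact l) by vm_compute.
rewrite /s !big_cons !big_nil /= -/s -/P.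
rewrite (dP x0 (\prod_(y <- [:: x1; x2; x3; x4; x5]) ('X - y%:P))); last first.
  by rewrite /P !big_cons !big_nil; ring.
rewrite (dP x1 (\prod_(y <- [:: x0; x2; x3; x4; x5]) ('X - y%:P))); last first.
  by rewrite /P !big_cons !big_nil; ring.
rewrite (dP x2 (\prod_(y <- [:: x0; x1; x3; x4; x5]) ('X - y%:P))); last first.
  by rewrite /P !big_cons !big_nil; ring.
rewrite (dP x3 (\prod_(y <- [:: x0; x1; x2; x4; x5]) ('X - y%:P))); last first.
  by rewrite /P !big_cons !big_nil; ring.
rewrite (dP x4 (\prod_(y <- [:: x0; x1; x2; x3; x5]) ('X - y%:P))); last first.
  by rewrite /P !big_cons !big_nil; ring.
rewrite (dP x5 (\prod_(y <- [:: x0; x1; x2; x3; x4]) ('X - y%:P))); last first.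
  by rewrite /P !big_cons !big_nil; ring.
rewrite !big_cons !big_nil !hornerE /=.
rewrite -(opprB x0 x1) -(opprB x0 x2) -(opprB x0 x3) -(opprB x0 x4).
rewrite -(opprB x0 x5) -(opprB x1 x2) -(opprB x1 x3) -(opprB x1 x4).
rewrite -(opprB x1 x5) -(opprB x2 x3) -(opprB x2 x4) -(opprB x2 x5).
rewrite -(opprB x3 x4) -(opprB x3 x5) -(opprB x4 x5).
move: (x0 - x1) (x0 - x2) (x0 - x3) (x0 - x4) (x0 - x5) (x1 - x2) (x1 - x3)
  (x1 - x4) (x1 - x5) (x2 - x3) (x2 - x4) (x2 - x5) (x3 - x4) (x3 - x5)
  (x4 - x5) => *; ring.
Qed.

Lemma square_diffs_perm (s t : seq K) : size s = 6%N -> perm_eq s t ->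
  square_diffs s index_pairs = square_diffs t index_pairs.
Proof.
move=> s6 st; move: (s6); rewrite (perm_size st).
case: t st => [|y0 [|y1 [|y2 [|y3 [|y4 [|y5 [|? ?]]]]]]] // st _.
case: s s6 st => [|x0 [|x1 [|x2 [|x3 [|x4 [|x5 [|? ?]]]]]]] // _ st.
rewrite !square_diffs_deriv (perm_big _ st) /=; congr (- _).
by under eq_bigr => z _ do rewrite (perm_big _ st).
Qed.

End SexticInvariants.

(** * The invariants of the curve in the coordinates m, p, D *)

Section Coordinates.
Variable R : comNzRingType.
Implicit Types a b m p D : R.

(** m = v - 9 - 2u, n = v - 27, p = m - n, and D = d / v is minus the
    discriminant of X^3 + a X^2 + b X + 1. *)
Definition coord_m a b := b ^+ 3 - 9 - 2 * (a * b).
Definition coord_n b := b ^+ 3 - 27.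
Definition coord_p a b := 18 - 2 * (a * b).
Definition coord_D a b :=
  4 * a ^+ 3 + 4 * b ^+ 3 - a ^+ 2 * b ^+ 2 - 18 * a * b + 27.

(** J_2, 4 J_4 and 8 J_6 of the curve: the multiples make the forms integral, so
    that they can be specialised over any commutative ring. *)
Definition form2 m p := 6 * m ^+ 2 - 4 * p ^+ 2.
Definition form4 m p D := p ^+ 4 - 48 * D * (3 * m - 4 * p).
Definition form6 m p D :=
  4 * m ^+ 2 * p ^+ 4 - 3 * p ^+ 6
  - 8 * D * (72 * m ^+ 3 - 96 * m ^+ 2 * p - 21 * m * p ^+ 2 + 40 * p ^+ 3)
  - 288 * D ^+ 2.

Lemma coord_nE a b : coord_n b = coord_m a b - coord_p a b.
Proof. by rewrite /coord_n /coord_m /coord_p; ring. Qed.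

End Coordinates.

Section Curve.
Variable K : closedFieldType.
Hypothesis char_K : [pchar K] =i pred0.
Variables a b : K.

Let f : {poly K} :=
  ('X^3 + a *: 'X^2 + b *: 'X + 1)
    * (4 *: 'X^3 + b ^+ 2 *: 'X^2 + (2 * b) *: 'X + 1).

Lemma natr_eq0 (n : nat) : (n%:R == 0 :> K) = (n == 0)%N.
Proof. by move/pcharf0P: char_K => ->. Qed.

Lemma curve_polyE :
  f = Poly [:: 1; 3 * b; a + 3 * b ^+ 2; 5 + 2 * a * b + b ^+ 3;
     6 * b + a * b ^+ 2; 4 * a + b ^+ 2; 4].
Proof. by rewrite /f -!mul_polyC /= !cons_poly_def; ring. Qed.

Lemma size_curve : size f = 7%N.
Proof.
by rewrite curve_polyE (PolyK (c := 0)) //= natr_eq0.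
Qed.

Lemma curve_J2 :
  igusa_clebsch_J2 f = form2 (coord_m a b) (coord_p a b).
Proof.
rewrite igusa_clebsch_J2E ?size_curve // curve_polyE !coef_Poly.
rewrite /form2 /coord_m /coord_p.
by cbv beta delta [sextic_J2]; cbv beta iota delta [nth]; ring.
Qed.

Lemma curve_J4 :
  4 * igusa_clebsch_J4 f =
  form4 (coord_m a b) (coord_p a b) (coord_D a b).
Proof.
rewrite igusa_clebsch_J4E ?size_curve // curve_polyE !coef_Poly.
rewrite /form4 /coord_m /coord_p /coord_D.
by cbv beta delta [sextic_J4]; cbv beta iota delta [nth]; ring.
Qed.

Lemma curve_J6 :
  8 * igusa_clebsch_J6 f =
  form6 (coord_m a b) (coord_p a b) (coord_D a b).
Proof.
rewrite igusa_clebsch_J6E ?size_curve // curve_polyE !coef_Poly.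
rewrite /form6 /coord_m /coord_p /coord_D.
by cbv beta delta [sextic_J6]; cbv beta iota delta [nth]; ring.
Qed.

Lemma cubic_discriminant (x y z : K) :
  let e1 := x + y + z in let e2 := x * y + x * z + y * z in
  let e3 := x * y * z in
  triangle x y z = e1 ^+ 2 * e2 ^+ 2 - 4 * e2 ^+ 3 - 4 * e1 ^+ 3 * e3
                   - 27 * e3 ^+ 2 + 18 * e1 * e2 * e3.
Proof. by move=> e1 e2 e3; rewrite /triangle /e1 /e2 /e3; ring. Qed.

Lemma cubic_quadratic_resultant (A B C x y z : K) :
  let e1 := x + y + z in let e2 := x * y + x * z + y * z in
  let e3 := x * y * z in
  (A * x ^+ 2 + B * x + C) * (A * y ^+ 2 + B * y + C)
    * (A * z ^+ 2 + B * z + C) =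
  A ^+ 3 * e3 ^+ 2 + A ^+ 2 * B * e2 * e3
  + A ^+ 2 * C * (e2 ^+ 2 - 2 * e1 * e3) + A * B ^+ 2 * e1 * e3
  + A * B * C * (e1 * e2 - 3 * e3) + A * C ^+ 2 * (e1 ^+ 2 - 2 * e2)
  + B ^+ 3 * e3 + B ^+ 2 * C * e2 + B * C ^+ 2 * e1 + C ^+ 3.
Proof. by move=> e1 e2 e3; rewrite /e1 /e2 /e3; ring. Qed.

Lemma cubic_split (c3 c2 c1 c0 : K) : c3 != 0 ->
  exists x y z, Poly [:: c0; c1; c2; c3] =
    c3 *: \prod_(w <- [:: x; y; z]) ('X - w%:P) /\
  [/\ c2 = - (c3 * (x + y + z)), c1 = c3 * (x * y + x * z + y * z) &
      c0 = - (c3 * (x * y * z))].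
Proof.
move=> c3n0; set F := Poly _.
have F4 : F = [:: c0; c1; c2; c3] :> seq K by rewrite (PolyK (c := 0)).
have sF : size F = 4%N by rewrite F4.
have lF : lead_coef F = c3 by rewrite lead_coefE sF F4.
have := poly_rootsP F; rewrite lF => FE.
have: size (poly_roots F) = 3%N.
  have : size F = (size (poly_roots F)).+1.
    by rewrite {1}FE size_scale // size_prod_XsubC.
  by rewrite sF => -[].
case: (poly_roots F) FE => [|x [|y [|z [|? ?]]]] // FE _.
exists x, y, z; split=> //.
have FE' : F = Poly [:: - (c3 * (x * y * z)); c3 * (x * y + x * z + y * z);
                        - (c3 * (x + y + z)); c3].
  by rewrite FE -!mul_polyC !big_cons big_nil /= !cons_poly_def; ring.
have cF i : F`_i = _ := congr1 (fun g : {poly K} => g`_i) FE'.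
have c0E := cF 0%N; have c1E := cF 1%N; have c2E := cF 2%N.
by move: c0E c1E c2E; rewrite !coef_Poly.
Qed.

(** The discriminant of a product is disc F disc G Res(F, G)^2.  Modulo F, the
    second factor G is the quadratic (b^2 - 4a) X^2 - 2b X - 3, so that
    Res(F, G) is the product of the values of this quadratic at the roots of
    F. *)
Lemma curve_J10 : igusa_clebsch_J10 f = - 16 * coord_n b * coord_D a b ^+ 3.
Proof.
have n4 : 4 != 0 :> K by rewrite natr_eq0.
have n1 : 1 != 0 :> K by apply: oner_neq0.
have [x0 [x1 [x2 [FE [aE bE oE]]]]] := cubic_split a b 1 n1.
have [y0 [y1 [y2 [GE [b2E b1E b0E]]]]] := cubic_split (b ^+ 2) (2 * b) 1 n4.
have f6 : f`_6 = 4 by rewrite curve_polyE coef_Poly.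
have fE : f = 4 *: \prod_(w <- [:: x0; x1; x2; y0; y1; y2]) ('X - w%:P).
  have -> : f = Poly [:: 1; b; a; 1] * Poly [:: 1; 2 * b; b ^+ 2; 4].
    by rewrite /f -!mul_polyC /= !cons_poly_def; ring.
  by rewrite FE GE -!mul_polyC !big_cons !big_nil /=; ring.
have lf : lead_coef f = 4 by rewrite lead_coefE size_curve.
have perm_f : perm_eq (poly_roots f) [:: x0; x1; x2; y0; y1; y2].
  apply: prod_XsubC_eq; apply: (scalerI n4).
  by rewrite -[RHS]fE [RHS]poly_rootsP lf.
rewrite /igusa_clebsch_J10 f6 (square_diffs_perm _ perm_f); last first.
  by rewrite (perm_size perm_f).
have Gx x : 4 * (x - y0) * (x - y1) * (x - y2) =
            4 * x ^+ 3 + b ^+ 2 * x ^+ 2 + (2 * b) * x + 1.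
  by rewrite b2E b1E [X in _ = _ + X]b0E; ring.
have Fx x : (x - x0) * (x - x1) * (x - x2) = x ^+ 3 + a * x ^+ 2 + b * x + 1.
  by rewrite aE bE [X in _ = _ + X]oE; ring.
have GF x : (x - x0) * (x - x1) * (x - x2) = 0 ->
  4 * (x - y0) * (x - y1) * (x - y2) =
  (b ^+ 2 - 4 * a) * x ^+ 2 + (- 2 * b) * x + (- 3).
  rewrite Fx Gx => Fx0; rewrite -[RHS]addr0 -(mulr0 4) -Fx0; ring.
have e1E : x0 + x1 + x2 = - a by rewrite aE; ring.
have e2E : x0 * x1 + x0 * x2 + x1 * x2 = b by rewrite bE; ring.
have e3E : x0 * x1 * x2 = - 1 by rewrite oE; ring.
have := cubic_quadratic_resultant (b ^+ 2 - 4 * a) (- 2 * b) (- 3) x0 x1 x2.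
rewrite /= -!GF; [|ring..]; rewrite e1E e2E e3E => resFG.
have discF := cubic_discriminant x0 x1 x2; rewrite /= e1E e2E e3E in discF.
have discG : 4 ^+ 4 * triangle y0 y1 y2 = 16 * coord_n b.
  have -> : 4 ^+ 4 * triangle y0 y1 y2 =
      (4 * (y0 + y1 + y2)) ^+ 2 * (4 * (y0 * y1 + y0 * y2 + y1 * y2)) ^+ 2
      - 16 * (4 * (y0 * y1 + y0 * y2 + y1 * y2)) ^+ 3
      - 4 * (4 * (y0 + y1 + y2)) ^+ 3 * (4 * (y0 * y1 * y2))
      - 432 * (4 * (y0 * y1 * y2)) ^+ 2
      + 72 * (4 * (y0 + y1 + y2)) * (4 * (y0 * y1 + y0 * y2 + y1 * y2))
        * (4 * (y0 * y1 * y2)).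
    by rewrite cubic_discriminant; ring.
  rewrite -b1E -[4 * (y0 + _ + _)]opprK -b2E -[4 * (y0 * _ * _)]opprK -b0E.
  by rewrite /coord_n; ring.
have discFE : triangle x0 x1 x2 = - coord_D a b.
  by rewrite discF /coord_D; ring.
set res := (X in X = _) in resFG.
have resE : res = - coord_D a b by rewrite resFG /coord_D; ring.
have -> : square_diffs [:: x0; x1; x2; y0; y1; y2] index_pairs =
  triangle x0 x1 x2 * triangle y0 y1 y2
  * ((x0 - y0) * (x0 - y1) * (x0 - y2) * ((x1 - y0) * (x1 - y1) * (x1 - y2))
     * ((x2 - y0) * (x2 - y1) * (x2 - y2))) ^+ 2.
  rewrite /square_diffs unlock /= /triangle.
  move: (x0 - x1) (x0 - x2) (x1 - x2) (y0 - y1) (y0 - y2) (y1 - y2)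
    (x0 - y0) (x0 - y1) (x0 - y2) (x1 - y0) (x1 - y1) (x1 - y2)
    (x2 - y0) (x2 - y1) (x2 - y2) => *; ring.
set c := (X in _ * _ * X ^+ 2).
have resc : res = 4 ^+ 3 * c by rewrite /res /c; ring.
transitivity (triangle x0 x1 x2 * (4 ^+ 4 * triangle y0 y1 y2)
              * (4 ^+ 3 * c) ^+ 2); first by ring.
by rewrite discG discFE -resc resE; ring.
Qed.

End Curve.

(** * Subfields given as sets *)

Section SubfieldType.
Variables (K : fieldType) (F : set K) (sF : is_subfield F).

(** The proof that F is a subfield is an argument, so that the predicate can
    carry its closure instance. *)
Definition subfield_mem of is_subfield F : {pred K} := fun x => `[< F x >].

Lemma subfield_memP x : reflect (F x) (x \in subfield_mem sF).
Proof. exact: asboolP. Qed.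

Fact subfield_mem_divring_closed : divring_closed (subfield_mem sF).
Proof.
case: sF => F1 FB FV; split; first exact/subfield_memP.
  by move=> x y /subfield_memP Fx /subfield_memP Fy; apply/subfield_memP/FB.
by move=> x y /subfield_memP Fx /subfield_memP Fy; apply/subfield_memP/FV.
Qed.

HB.instance Definition _ :=
  GRing.isDivringClosed.Build K (subfield_mem sF) subfield_mem_divring_closed.

Definition subfield_type of is_subfield F := {x : K | x \in subfield_mem sF}.
HB.instance Definition _ := SubChoice.on (subfield_type sF).
HB.instance Definition _ :=
  [SubChoice_isSubIntegralDomain of subfield_type sF by <:].
HB.instance Definition _ :=
  [SubIntegralDomain_isSubField of subfield_type sF by <:].

(** The greatest common divisor of E1 and E2 is X - z up to a scalar, and it
    does not depend on the field in which it is computed: its coefficients,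
    whose quotient is - z, can be taken in F. *)
Lemma subfield_common_root (E1 E2 Q1 Q2 : {poly K}) (z : K) :
  E1 \is a polyOver (subfield_mem sF) -> E2 \is a polyOver (subfield_mem sF) ->
  E1 = Q1 * ('X - z%:P) -> E2 = Q2 * ('X - z%:P) -> coprimep Q1 Q2 -> F z.
Proof.
have lift (E : {poly K}) : E \is a polyOver (subfield_mem sF) ->
    exists E' : {poly subfield_type sF}, map_poly val E' = E.
  move=> /polyOverP FE.
  exists (\poly_(i < size E) (Sub E`_i (FE i) : subfield_type sF)).
  apply/polyP=> i; rewrite coef_map coef_poly; case: ltnP => [//|ltEi].
  by rewrite nth_default //= raddf0.
move=> /lift[E1' E1'E] /lift[E2' E2'E] E1E E2E co12.
have gE : map_poly val (gcdp E1' E2') %= 'X - z%:P.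
  rewrite gcdp_map E1'E E2'E E1E E2E.
  apply: eqp_trans (gcdp_mul2r _ _ _) _.
  rewrite -[X in _ %= X]mul1r; apply: eqp_mulr.
  by rewrite gcdp_eqp1.
have g2 : size (gcdp E1' E2') = 2%N.
  by rewrite -(size_map_poly val) (eqp_size gE) size_XsubC.
have /eqP : root (map_poly val (gcdp E1' E2')) z.
  by rewrite (eqp_root gE) root_XsubC.
set g := gcdp E1' E2' in g2 *.
rewrite horner_coef size_map_poly g2 !big_ord_recl big_ord0 !coef_map /=.
rewrite expr0 expr1 mulr1 addr0 => g0z.
have g1n0 : val g`_1 != 0.
  have : lead_coef g != 0 by rewrite lead_coef_eq0 -size_poly_eq0 g2.
  by rewrite lead_coefE g2 (inj_eq val_inj (g`_1) 0).
have -> : z = - val g`_0 / val g`_1.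
  apply: (canRL (mulfK g1n0)); rewrite mulrC; apply/eqP.
  by rewrite -addr_eq0 addrC g0z.
by apply/(subfield_memP); rewrite rpred_div ?rpredN ?(valP g`_0) ?(valP g`_1).
Qed.

End SubfieldType.

Ltac solve_mem := repeat first
  [ assumption | exact: rpred1 | exact: rpred_nat | rewrite rpredN
  | apply: rpredD | apply: rpred_div | apply: rpredM | apply: rpredX
  | exact: polyOverX | rewrite polyOverC ].

Section Adjoin.
Variables (k K : fieldType) (phi : {rmorphism k -> K}).

Lemma adjoin_subfield (S : set K) : is_subfield (adjoin_field phi S).
Proof.
split=> [F [[]] //|x y Sx Sy F FS|x y Sx Sy F FS].
  by have [[_ FB _] _] := FS; apply: FB; [apply: Sx | apply: Sy].
by have [[_ _ FV] _] := FS; apply: FV; [apply: Sx | apply: Sy].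
Qed.

Lemma sub_adjoin (S : set K) : S `<=` adjoin_field phi S.
Proof. by move=> x Sx F [_]; apply; right. Qed.

Lemma adjoin_min (S F : set K) : is_subfield F -> (forall c, F (phi c)) ->
  S `<=` F -> adjoin_field phi S `<=` F.
Proof. by move=> sF Fphi SF x; apply; split=> // y [[c _ <-]|/SF]. Qed.

Lemma adjoin_scalar (S : set K) c : adjoin_field phi S (phi c).
Proof. by move=> F [_]; apply; left; exists c. Qed.

End Adjoin.

Section QuadraticExtension.
Variables (K : fieldType) (F : set K) (w : K).
Hypotheses (sF : is_subfield F) (Fw2 : F (w ^+ 2)) (Fw : ~ F w).

Definition quadratic_span : set K :=
  [set x | exists c0 c1, [/\ F c0, F c1 & x = c0 + c1 * w]].

Lemma quadratic_free c0 c1 :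
  F c0 -> F c1 -> c0 + c1 * w = 0 -> c0 = 0 /\ c1 = 0.
Proof.
move=> /(subfield_memP sF) Fc0 /(subfield_memP sF) Fc1 c01.
have [c10|c1n0] := eqVneq c1 0.
  by split=> //; rewrite -c01 c10 mul0r addr0.
case: Fw; have -> : w = - c0 / c1.
  apply: (canRL (mulfK c1n0)); rewrite mulrC; apply/eqP.
  by rewrite -addr_eq0 addrC c01.
by apply/(subfield_memP sF); rewrite rpred_div ?rpredN.
Qed.

Lemma quadratic_span_subfield : is_subfield quadratic_span.
Proof.
have Fw2' : w ^+ 2 \in subfield_mem sF by apply/subfield_memP.
split.
- exists 1, 0; split; last by rewrite mul0r addr0.
    by apply/(subfield_memP sF); rewrite rpred1.
  by apply/(subfield_memP sF); rewrite rpred0.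
- move=> _ _ [c0 [c1 [Fc0 Fc1 ->]]] [d0 [d1 [Fd0 Fd1 ->]]].
  exists (c0 - d0), (c1 - d1); split; last by ring.
    by have [_ FB _] := sF; apply: FB.
  by have [_ FB _] := sF; apply: FB.
move=> _ _ [c0 [c1 [Fc0 Fc1 ->]]] [d0 [d1 [Fd0 Fd1 ->]]].
have {Fc0}/(subfield_memP sF) Fc0 := Fc0.
have {Fc1}/(subfield_memP sF) Fc1 := Fc1.
have [d00|dn0] := eqVneq (d0 + d1 * w) 0.
  rewrite d00 invr0 mulr0; exists 0, 0; rewrite mul0r addr0.
  by split=> //; apply/(subfield_memP sF); rewrite rpred0.
(* The norm of the denominator, used to rationalise the quotient. *)
have Nn0 : d0 ^+ 2 - d1 ^+ 2 * w ^+ 2 != 0.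
  have -> : d0 ^+ 2 - d1 ^+ 2 * w ^+ 2 = (d0 + d1 * w) * (d0 + - d1 * w).
    by ring.
  have FNd1 : F (- d1).
    have {Fd1}/(subfield_memP sF) Fd1 := Fd1.
    by apply/(subfield_memP sF); rewrite rpredN.
  rewrite mulf_neq0 //; apply/eqP => /(quadratic_free Fd0 FNd1)[d0E /eqP].
  rewrite oppr_eq0 => /eqP d1E.
  by move: dn0; rewrite d0E d1E mul0r addr0 eqxx.
have {Fd0}/(subfield_memP sF) Fd0 := Fd0.
have {Fd1}/(subfield_memP sF) Fd1 := Fd1.
exists ((c0 * d0 - c1 * d1 * w ^+ 2) / (d0 ^+ 2 - d1 ^+ 2 * w ^+ 2)),
  ((c1 * d0 - c0 * d1) / (d0 ^+ 2 - d1 ^+ 2 * w ^+ 2)); split.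
- apply/(subfield_memP sF); move: (w ^+ 2) Fw2' => W FW.
  by rewrite rpred_div ?rpredB ?rpredM ?rpredX.
- apply/(subfield_memP sF); move: (w ^+ 2) Fw2' => W FW.
  by rewrite rpred_div ?rpredB ?rpredM ?rpredX.
by field; rewrite exprMn Nn0 dn0.
Qed.

Lemma has_degree2 (E : set K) : is_subfield E -> F `<=` E -> E w ->
  E `<=` quadratic_span -> has_degree F E 2.
Proof.
move=> sE FE Ew EF; split=> //.
exists (fun i : 'I_2 => if i == ord0 then 1 else w); split.
- by move=> i; case: (i == ord0) => //; have [] := sE.
- move=> x /EF[c0 [c1 [Fc0 Fc1 ->]]].
  exists (fun i : 'I_2 => if i == ord0 then c0 else c1); split.
    by move=> i; case: (i == ord0).
  by rewrite !big_ord_recl big_ord0 /= mulr1 addr0.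
move=> c Fc; rewrite !big_ord_recl big_ord0 /= mulr1 addr0.
move=> /(quadratic_free (Fc _) (Fc _))[c0 c1] i.
have [->|] := eqVneq i ord0; first exact: c0.
case: i => [[|[|//]] lti] // _.
by rewrite -[RHS]c1; congr (c _); apply: val_inj.
Qed.

End QuadraticExtension.

Section Agreement.
Variables (R : idomainType) (K : fieldType) (h h' : {rmorphism R -> K}).
Hypothesis h_inj : injective h.

(** The fractions whose values through h and through h' are defined and equal.
    This is the fixed field of the substitution that takes h to h', without
    having to define this substitution on all fractions. *)
Definition agreement_field : set K :=
  [set x | exists P Q,
    [/\ h Q != 0, h' Q != 0, x = h P / h Q & x = h' P / h' Q]].

Lemma agreement_subfield : is_subfield agreement_field.
Proof.
split.
- by exists 1, 1; rewrite !rmorph1 oner_neq0 divr1.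
- move=> x y [P [Q [hQ hQ' xE xE']]] [S [T [hT hT' yE yE']]].
  exists (P * T - S * Q), (Q * T); rewrite !rmorphB !rmorphM !mulf_neq0 //.
  split=> //; first by rewrite xE yE; field; rewrite hQ hT.
  by rewrite xE' yE'; field; rewrite hQ' hT'.
move=> x y [P [Q [hQ hQ' xE xE']]] [S [T [hT hT' yE yE']]].
have [y0|yn0] := eqVneq y 0.
  by exists 0, 1; rewrite y0 invr0 mulr0 !rmorph0 !rmorph1 oner_neq0 !mul0r.
have hS : h S != 0 by move: yn0; rewrite yE mulf_eq0 negb_or => /andP[].
have hS' : h' S != 0 by move: yn0; rewrite yE' mulf_eq0 negb_or => /andP[].
exists (P * T), (Q * S); rewrite !rmorphM !mulf_neq0 //.
split=> //; first by rewrite xE yE; field; rewrite hQ hS hT.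
by rewrite xE' yE'; field; rewrite hQ' hS' hT'.
Qed.

(** Injectivity of h turns an equality of values through h into an identity,
    which h' then preserves. *)
Lemma agreement_eq P : agreement_field (h P) -> h P = h' P.
Proof.
move=> [S [Q [hQ hQ' E E']]]; rewrite E'; apply: (canLR (mulfK hQ')).
rewrite -!rmorphM; congr (h' _); apply: h_inj.
by rewrite rmorphM E mulfVK.
Qed.

End Agreement.

(** * Leading coefficients and coprimality under specialisation *)

Section Top.
Variable R : nzRingType.
Implicit Types p q : {poly R}.

(** The coefficient c of X^n may be 0: the relation is then compatible with sums
    and products without a condition on cancellation. *)
Definition degree_top n p c := (size p <= n.+1)%N /\ p`_n = c.

Lemma degree_topC c : degree_top 0 c%:P c.
Proof. by split; rewrite ?size_polyC_leq1 ?coefC. Qed.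

Lemma degree_topX : degree_top 1 'X 1.
Proof. by split; rewrite ?size_polyX ?coefX. Qed.

Lemma degree_top_lift n m p c :
  degree_top n p c -> (n < m)%N -> degree_top m p 0.
Proof.
move=> [sp _] nm; split; first exact: leq_trans sp (leqW nm).
by rewrite nth_default // (leq_trans sp).
Qed.

Lemma degree_topD n p q c d :
  degree_top n p c -> degree_top n q d -> degree_top n (p + q) (c + d).
Proof.
move=> [sp <-] [sq <-]; split; last by rewrite coefD.
by rewrite (leq_trans (size_polyD _ _)) // geq_max sp.
Qed.

Lemma degree_topN n p c : degree_top n p c -> degree_top n (- p) (- c).
Proof. by move=> [sp <-]; split; rewrite ?size_polyN ?coefN. Qed.

Lemma degree_topM n m p q c d :
  degree_top n p c -> degree_top m q d -> degree_top (n + m) (p * q) (c * d).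
Proof.
move=> [sp <-] [sq <-]; split.
  by apply: leq_trans (size_polyMleq _ _) _; lia.
have ltn : (n < (n + m).+1)%N by rewrite ltnS leq_addr.
rewrite coefM (bigD1 (Ordinal ltn)) //= addKn big1 ?addr0 // => j.
rewrite -val_eqE /= => jn; case: (ltnP j n) => jn'.
  by rewrite [q`_ _]nth_default ?mulr0 //; apply: leq_trans sq _; lia.
by rewrite nth_default ?mul0r // (leq_trans sp) // ltn_neqAle eq_sym jn.
Qed.

Lemma degree_topXn n p c k :
  degree_top n p c -> degree_top (k * n) (p ^+ k) (c ^+ k).
Proof.
move=> pc; elim: k => [|k IH]; first by rewrite !expr0; apply: degree_topC.
by rewrite !exprS mulSn; apply: degree_topM.
Qed.

Lemma degree_top_lead n p c : degree_top n p c -> c != 0 -> lead_coef p = c.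
Proof.
move=> [sp <-] pn0; rewrite lead_coefE; congr (p`_ _).
have: (n < size p)%N by rewrite ltnNge; apply: contra pn0 => /leq_sizeP->.
case: (size p) sp => //= s; rewrite !ltnS => sn ns.
by apply/eqP; rewrite eqn_leq sn.
Qed.

End Top.

Section Eval.
Variables (k K : fieldType) (phi : {rmorphism k -> K}) (a b : K).

Definition eval2 (P : {poly {poly k}}) : K :=
  (map_poly (map_poly phi) P).[a, b].
HB.instance Definition _ := GRing.RMorphism.copy eval2
  (horner_eval b \o horner_eval a%:P \o map_poly (map_poly phi)).

Lemma eval2X : eval2 'X = a.
Proof. by rewrite /eval2 map_polyX hornerX hornerC. Qed.

Lemma eval2Y : eval2 'X%:P = b.
Proof. by rewrite /eval2 map_polyC hornerC /= map_polyX hornerX. Qed.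

Lemma eval2C c : eval2 c%:P%:P = phi c.
Proof. by rewrite /eval2 map_polyC hornerC /= map_polyC hornerC. Qed.

Lemma eval2_inj : alg_independent2 phi a b -> injective eval2.
Proof.
move=> indep P Q PQ; apply/eqP; rewrite -subr_eq0; apply/eqP/indep.
have -> : (map_poly (map_poly phi) (P - Q)).[a, b] = eval2 P - eval2 Q.
  exact: (rmorphB eval2 P Q).
by rewrite PQ subrr.
Qed.

End Eval.

Section CoprimeLift.
Variables (A : idomainType) (K : fieldType) (h h0 : {rmorphism {poly A} -> K}).
Hypothesis h_inj : injective h.

Lemma coprimep_resultant (P Q : {poly K}) :
  P != 0 -> coprimep P Q = (resultant P Q != 0).
Proof.
move=> Pn0; rewrite resultant_eq0 /coprimep -leqNgt.
have : gcdp P Q != 0 by rewrite gcdp_eq0 (negPf Pn0).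
by rewrite -size_poly_gt0; case: (size _) => [|[|n]].
Qed.

(** The resultant commutes with h and h0 as long as the leading coefficients
    survive, so it is nonzero through h as soon as it is through h0. *)
Lemma coprimep_lift (P Q : {poly {poly A}}) :
  h0 (lead_coef P) != 0 -> h0 (lead_coef Q) != 0 ->
  coprimep (map_poly h0 P) (map_poly h0 Q) ->
  coprimep (map_poly h P) (map_poly h Q).
Proof.
have hn0 c : h0 c != 0 -> h c != 0.
  apply: contra => /eqP hc.
  by rewrite (h_inj (etrans hc (esym (rmorph0 h)))) rmorph0.
have mapn0 (g : {rmorphism {poly A} -> K}) (S : {poly {poly A}}) :
    g (lead_coef S) != 0 -> map_poly g S != 0.
  move=> gS; rewrite -size_poly_gt0 size_map_poly_id0 // lt0n.
  apply: contra gS; rewrite size_poly_eq0 => /eqP->.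
  by rewrite lead_coef0 rmorph0.
move=> P0 Q0; have [hP hQ] := (hn0 _ P0, hn0 _ Q0).
rewrite !coprimep_resultant ?mapn0 //.
by rewrite -!map_resultant //; apply: hn0.
Qed.

End CoprimeLift.

(** * Elimination of m / p from the invariants *)

Section Elimination.
Variable R : comNzRingType.

(** For m, p, D with invariants J2 = [form2 m p], I4 = [form4 m p D],
    I6 = [form6 m p D] and T = (m - p) D^3, and for Z = m, the quartic
    [elim_A] equals 48 J2^2 D (3m - 4p).  This determines D when J2, I4 and Z
    are known; [elim1] and [elim2] come from putting this value of D in the
    equations for T / J2^5 and I6 / J2^3, after clearing denominators.  The
    factors J2 and p make both homogeneous, so that their coefficients are
    polynomials in a and b. *)
Definition elim_A (J2 I4 p Z : R) := J2 ^+ 2 * p ^+ 4 - I4 * form2 Z p ^+ 2.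

Definition elim1 (J2 I4 T p Z : R) :=
  elim_A J2 I4 p Z ^+ 3 * (Z - p)
  - 48 ^+ 3 * (3 * Z - 4 * p) ^+ 3 * J2 * T * form2 Z p ^+ 5.

Definition elim2 (J2 I4 I6 p Z : R) :=
  3 * elim_A J2 I4 p Z ^+ 2
  + 48 * J2 ^+ 2 * p ^+ 3 * elim_A J2 I4 p Z * (3 * Z - 4 * p)
  + 4 * J2 ^+ 2 * (4 * form2 Z p + 9 * p ^+ 2) * elim_A J2 I4 p Z
    * (3 * Z - 4 * p) ^+ 2
  + 8 * J2 * (3 * Z - 4 * p) ^+ 2
    * (J2 ^+ 3 * p ^+ 4 * (p ^+ 2 - 2 * form2 Z p) + 3 * I6 * form2 Z p ^+ 3).

Lemma elim1_root m p D :
  elim1 (form2 m p) (form4 m p D) ((m - p) * D ^+ 3) p m = 0.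
Proof. by rewrite /elim1 /elim_A /form4 /form2; ring. Qed.

Lemma elim2_root m p D :
  elim2 (form2 m p) (form4 m p D) (form6 m p D) p m = 0.
Proof. by rewrite /elim2 /elim_A /form6 /form4 /form2; ring. Qed.

Lemma elim1_scale J2 I4 T p Z :
  elim1 J2 (I4 * J2 ^+ 2) (T * J2 ^+ 5) p (p * Z) =
  J2 ^+ 6 * p ^+ 13 * elim1 1 I4 T 1 Z.
Proof. by rewrite /elim1 /elim_A /form2; ring. Qed.

Lemma elim2_scale J2 I4 I6 p Z :
  elim2 J2 (I4 * J2 ^+ 2) (I6 * J2 ^+ 3) p (p * Z) =
  J2 ^+ 4 * p ^+ 8 * elim2 1 I4 I6 1 Z.
Proof. by rewrite /elim2 /elim_A /form2; ring. Qed.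

End Elimination.

Section Morphism.
Variables (R S : comNzRingType) (h : {rmorphism R -> S}).

Lemma rmorph_coord_m a b : h (coord_m a b) = coord_m (h a) (h b).
Proof. by rewrite /coord_m; ring. Qed.
Lemma rmorph_coord_n b : h (coord_n b) = coord_n (h b).
Proof. by rewrite /coord_n; ring. Qed.
Lemma rmorph_coord_p a b : h (coord_p a b) = coord_p (h a) (h b).
Proof. by rewrite /coord_p; ring. Qed.
Lemma rmorph_coord_D a b : h (coord_D a b) = coord_D (h a) (h b).
Proof. by rewrite /coord_D; ring. Qed.
Lemma rmorph_form2 m p : h (form2 m p) = form2 (h m) (h p).
Proof. by rewrite /form2; ring. Qed.
Lemma rmorph_form4 m p D : h (form4 m p D) = form4 (h m) (h p) (h D).
Proof. by rewrite /form4; ring. Qed.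
Lemma rmorph_form6 m p D : h (form6 m p D) = form6 (h m) (h p) (h D).
Proof. by rewrite /form6; ring. Qed.
Lemma rmorph_elim_A J2 I4 p Z :
  h (elim_A J2 I4 p Z) = elim_A (h J2) (h I4) (h p) (h Z).
Proof. by rewrite /elim_A /form2; ring. Qed.
Lemma rmorph_elim1 J2 I4 T p Z :
  h (elim1 J2 I4 T p Z) = elim1 (h J2) (h I4) (h T) (h p) (h Z).
Proof. by rewrite /elim1 /elim_A /form2; ring. Qed.
Lemma rmorph_elim2 J2 I4 I6 p Z :
  h (elim2 J2 I4 I6 p Z) = elim2 (h J2) (h I4) (h I6) (h p) (h Z).
Proof. by rewrite /elim2 /elim_A /form2; ring. Qed.

End Morphism.

Section LeadingTerms.
Variables (R : comNzRingType) (J2 I4 I6 T p : R).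

Lemma degree_top_nat n : degree_top 0 (n%:R : {poly R}) n%:R.
Proof. by rewrite -polyC_natr; apply: degree_topC. Qed.

Lemma degree_top_form2 : degree_top 2 (form2 'X p%:P) 6.
Proof.
have -> : 6 = 6 * 1 ^+ 2 - 0 :> R by ring.
apply: degree_topD.
  exact: (degree_topM (degree_top_nat 6) (degree_topXn 2 (degree_topX R))).
apply: degree_topN; apply: degree_top_lift (_ : (0 < 2)%N) => //.
exact: (degree_topM (degree_top_nat 4) (degree_topXn 2 (degree_topC p))).
Qed.

Lemma degree_top_elim_A :
  degree_top 4 (elim_A J2%:P I4%:P p%:P 'X) (0 - I4 * 6 ^+ 2).
Proof.
apply: degree_topD.
  apply: degree_top_lift (_ : (0 < 4)%N) => //.
  exact: (degree_topM (degree_topXn 2 (degree_topC J2))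
    (degree_topXn 4 (degree_topC p))).
apply: degree_topN.
exact: (degree_topM (degree_topC I4) (degree_topXn 2 degree_top_form2)).
Qed.

Lemma degree_top_linear : degree_top 1 (3 * 'X - 4 * p%:P) (3 * 1 - 0).
Proof.
apply: degree_topD.
  exact: (degree_topM (degree_top_nat 3) (degree_topX R)).
apply: degree_topN; apply: degree_top_lift (_ : (0 < 1)%N) => //.
exact: (degree_topM (degree_top_nat 4) (degree_topC p)).
Qed.

Lemma lead_elim1 :
  let c := - (36 * I4) ^+ 3 - 48 ^+ 3 * 27 * 6 ^+ 5 * (J2 * T) in
  c != 0 -> lead_coef (elim1 J2%:P I4%:P T%:P p%:P 'X) = c.
Proof.
move=> c; apply: (@degree_top_lead _ 13).
rewrite [c](_ : _ = (0 - I4 * 6 ^+ 2) ^+ 3 * (1 - 0)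
  - 48 ^+ 3 * (3 * 1 - 0) ^+ 3 * J2 * T * 6 ^+ 5); last by rewrite /c; ring.
apply: degree_topD.
  apply: (degree_topM (degree_topXn 3 degree_top_elim_A)).
  apply: degree_topD; first exact: degree_topX.
  by apply: degree_topN; apply: degree_top_lift (degree_topC p) _.
apply: degree_topN.
apply: (@degree_topM _ 3 10); last exact: (degree_topXn 5 degree_top_form2).
apply: (@degree_topM _ 3 0); last exact: degree_topC.
apply: (@degree_topM _ 3 0); last exact: degree_topC.
exact: (degree_topM (degree_topXn 3 (degree_top_nat 48))
  (degree_topXn 3 degree_top_linear)).
Qed.

Lemma lead_elim2 :
  let c := 3 * (36 * I4) ^+ 2 - 4 * 24 * 36 * 9 * J2 ^+ 2 * I4
           + 8 * 9 * 3 * 216 * J2 * I6 in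
  c != 0 -> lead_coef (elim2 J2%:P I4%:P I6%:P p%:P 'X) = c.
Proof.
move=> c; apply: (@degree_top_lead _ 8).
rewrite [c](_ : _ = 3 * (0 - I4 * 6 ^+ 2) ^+ 2 + 0
  + 4 * J2 ^+ 2 * (4 * 6 + 0) * (0 - I4 * 6 ^+ 2) * (3 * 1 - 0) ^+ 2
  + 8 * J2 * (3 * 1 - 0) ^+ 2 * (0 + 3 * I6 * 6 ^+ 3)); last first.
  by rewrite /c; ring.
have topA := degree_top_elim_A; have tope := degree_top_linear.
have topF := degree_top_form2.
apply: degree_topD; [apply: degree_topD; [apply: degree_topD|]|].
- exact: (degree_topM (degree_top_nat 3) (degree_topXn 2 topA)).
- apply: degree_top_lift (_ : (5 < 8)%N) => //.
  apply: (@degree_topM _ 4 1) tope; apply: (@degree_topM _ 0 4) topA.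
  apply: (@degree_topM _ 0 0) (degree_topXn 3 (degree_topC p)).
  exact: (degree_topM (degree_top_nat 48) (degree_topXn 2 (degree_topC J2))).
- apply: (@degree_topM _ 6 2) (degree_topXn 2 tope).
  apply: (@degree_topM _ 2 4) topA; apply: (@degree_topM _ 0 2).
    exact: (degree_topM (degree_top_nat 4) (degree_topXn 2 (degree_topC J2))).
  apply: degree_topD; first exact: (degree_topM (degree_top_nat 4) topF).
  apply: degree_top_lift (_ : (0 < 2)%N) => //.
  exact: (degree_topM (degree_top_nat 9) (degree_topXn 2 (degree_topC p))).
apply: (degree_topM (degree_topM
  (degree_topM (degree_top_nat 8) (degree_topC J2)) (degree_topXn 2 tope))).
apply: degree_topD.
  apply: degree_top_lift (_ : (2 < 6)%N) => //.
  apply: (degree_topM (degree_topM (degree_topXn 3 (degree_topC J2))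
    (degree_topXn 4 (degree_topC p)))).
  apply: degree_topD.
    apply: degree_top_lift (_ : (0 < 2)%N) => //.
    exact: (degree_topXn 2 (degree_topC p)).
  exact: (degree_topN (degree_topM (degree_top_nat 2) topF)).
exact: (degree_topM (degree_topM (degree_top_nat 3) (degree_topC I6))
  (degree_topXn 3 topF)).
Qed.

End LeadingTerms.

Section SpecialPoint.
Variable K : closedFieldType.
Hypothesis char_K : [pchar K] =i pred0.

(** The point (a, b) = (2, 3) has m = p = 6 and D = 23.  With x = 6y and
    g = 3y^2 - 2, so that [form2 x 6] is 72 g, the quartic reduces to
    9 - 55 g^2 and the remaining factor of the second polynomial to
    54 - 216 g + 323 g^3. *)
Lemma special_no_common_root (x : K) :
  elim_A (form2 6 6) (form4 6 6 23) 6 x = 0 ->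
  elim2 (form2 6 6) (form4 6 6 23) (form6 6 6 23) 6 x != 0.
Proof.
have nz n : (n != 0)%N -> n%:R != 0 :> K by rewrite natr_eq0.
move=> A0; apply/eqP => E0.
pose y := x / 6; have xE : x = 6 * y by rewrite /y; field; apply: (nz 6).
pose g := 3 * y ^+ 2 - 2.
have g2 : 9 - 55 * g ^+ 2 = 0.
  have : (72 ^+ 2 * 144) * (9 - 55 * g ^+ 2) = 0.
    by rewrite -A0 xE /g /elim_A /form2 /form4; ring.
  move/eqP; rewrite mulf_eq0 => /orP[|/eqP //].
  by rewrite (negPf (_ : 72 ^+ 2 * 144 != 0)) // ?mulf_neq0 ?expf_neq0 ?nz.
have : (8 * 72 ^+ 4 * 864) * (3 * x - 24) ^+ 2
       * (54 - 216 * g + 323 * g ^+ 3) = 0.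
  by rewrite -E0 /elim2 A0 xE /g /form2 /form6; ring.
move/eqP; rewrite mulf_eq0 mulf_eq0.
rewrite (negPf (_ : 8 * 72 ^+ 4 * 864 != 0)) /=; last first.
  by rewrite ?mulf_neq0 ?expf_neq0 ?nz.
case/orP => [|/eqP g3].
  rewrite expf_eq0 /= => /eqP x8.
  have yE : y = 4 / 3.
    have -> : y = (3 * x - 24) / 18 + 4 / 3.
      by rewrite xE; field; rewrite !nz.
    by rewrite x8 mul0r add0r.
  (* The factor 3x - 24 vanishes at y = 4/3, where g = 10/3. *)
  have : 5419%:R / 9 = 0 :> K.
    by rewrite -[RHS]oppr0 -g2 /g yE; field; rewrite !nz.
  by apply/eqP; rewrite mulf_neq0 ?invr_eq0 ?nz.
(* Bezout identity for the two polynomials in g. *)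
have : (9 * 3 ^+ 5 * 23 ^+ 3 : K) = 0.
  transitivity (9 * 997 ^+ 2 * (9 - 55 * g ^+ 2)
    - (55 * (54 - 216 * g + 323 * g ^+ 3) + 323 * g * (9 - 55 * g ^+ 2))
      * (55 * (330 + 997 * g))); first by ring.
  by rewrite g2 g3; ring.
by apply/eqP; rewrite ?mulf_neq0 ?expf_neq0 ?nz.
Qed.

End SpecialPoint.

Section GenericCurve.
Variable k : fieldType.

Definition gen_m : {poly {poly k}} := coord_m 'X 'X%:P.
Definition gen_p : {poly {poly k}} := coord_p 'X 'X%:P.
Definition gen_D : {poly {poly k}} := coord_D 'X 'X%:P.
Definition gen_J2 := form2 gen_m gen_p.
Definition gen_I4 := form4 gen_m gen_p gen_D.
Definition gen_I6 := form6 gen_m gen_p gen_D.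
Definition gen_T := (gen_m - gen_p) * gen_D ^+ 3.

Variables (K : fieldType) (phi : {rmorphism k -> K}) (x y : K).
Local Notation h := (eval2 phi x y : {rmorphism {poly {poly k}} -> K}).
Local Notation m := (coord_m x y).
Local Notation p := (coord_p x y).
Local Notation D := (coord_D x y).

Lemma eval_gen_m : h gen_m = m.
Proof.
by have := rmorph_coord_m h 'X 'X%:P; rewrite /= eval2X eval2Y.
Qed.

Lemma eval_gen_p : h gen_p = p.
Proof.
by have := rmorph_coord_p h 'X 'X%:P; rewrite /= eval2X eval2Y.
Qed.

Lemma eval_gen_D : h gen_D = D.
Proof.
by have := rmorph_coord_D h 'X 'X%:P; rewrite /= eval2X eval2Y.
Qed.

Lemma eval_gen_J2 : h gen_J2 = form2 m p.
Proof.
by have := rmorph_form2 h gen_m gen_p; rewrite /= eval_gen_m eval_gen_p.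
Qed.

Lemma eval_gen_I4 : h gen_I4 = form4 m p D.
Proof.
have := rmorph_form4 h gen_m gen_p gen_D.
by rewrite /= eval_gen_m eval_gen_p eval_gen_D.
Qed.

Lemma eval_gen_I6 : h gen_I6 = form6 m p D.
Proof.
have := rmorph_form6 h gen_m gen_p gen_D.
by rewrite /= eval_gen_m eval_gen_p eval_gen_D.
Qed.

Lemma eval_gen_T : h gen_T = (m - p) * D ^+ 3.
Proof.
rewrite /gen_T (rmorphM h) (rmorphB h) (rmorphXn h) /=.
by rewrite eval_gen_m eval_gen_p eval_gen_D.
Qed.

Definition gen_elim1 : {poly {poly {poly k}}} :=
  elim1 gen_J2%:P gen_I4%:P gen_T%:P gen_p%:P 'X.
Definition gen_elim2 : {poly {poly {poly k}}} :=
  elim2 gen_J2%:P gen_I4%:P gen_I6%:P gen_p%:P 'X.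

Lemma map_gen_elim1 : map_poly h gen_elim1 =
  elim1 (form2 m p)%:P (form4 m p D)%:P ((m - p) * D ^+ 3)%:P p%:P 'X.
Proof.
have := rmorph_elim1 (map_poly h) gen_J2%:P gen_I4%:P gen_T%:P gen_p%:P 'X.
rewrite /= !map_polyC map_polyX /=.
by rewrite eval_gen_J2 eval_gen_I4 eval_gen_T eval_gen_p.
Qed.

Lemma map_gen_elim2 : map_poly h gen_elim2 =
  elim2 (form2 m p)%:P (form4 m p D)%:P (form6 m p D)%:P p%:P 'X.
Proof.
have := rmorph_elim2 (map_poly h) gen_J2%:P gen_I4%:P gen_I6%:P gen_p%:P 'X.
rewrite /= !map_polyC map_polyX /=.
by rewrite eval_gen_J2 eval_gen_I4 eval_gen_I6 eval_gen_p.
Qed.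

End GenericCurve.

Section Generic.
Variables (k K : closedFieldType) (phi : {rmorphism k -> K}) (a b : K).
Hypothesis char_K : [pchar K] =i pred0.
Hypothesis indep_ab : alg_independent2 phi a b.

(** The test for being nonzero on which all later ones rest: by independence, a
    vanishing polynomial expression in a and b vanishes everywhere. *)
Lemma eval2_neq0 (P : {poly {poly k}}) (a0 b0 : K) :
  eval2 phi a0 b0 P != 0 -> eval2 phi a b P != 0.
Proof.
apply: contra => /eqP P0; suff -> : P = 0 by rewrite rmorph0.
by apply: (eval2_inj indep_ab); rewrite P0 rmorph0.
Qed.

Local Notation m := (coord_m a b).
Local Notation p := (coord_p a b).
Local Notation D := (coord_D a b).
Local Notation J2 := (form2 m p).
Local Notation I4 := (form4 m p D).
Local Notation I6 := (form6 m p D).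
Local Notation T := ((m - p) * D ^+ 3).

Lemma special_coords :
  [/\ coord_m 2 3 = 6 :> K, coord_p 2 3 = 6 :> K & coord_D 2 3 = 23 :> K].
Proof.
by rewrite /coord_m /coord_p /coord_D; split; ring.
Qed.

Lemma coord_p_neq0 : p != 0.
Proof.
rewrite -(eval_gen_p phi); apply: (@eval2_neq0 _ 2 3).
rewrite eval_gen_p.
by have [_ -> _] := special_coords; rewrite natr_eq0.
Qed.

Lemma form2_neq0 : J2 != 0.
Proof.
rewrite -(eval_gen_J2 phi); apply: (@eval2_neq0 _ 2 3).
rewrite eval_gen_J2.
have [-> -> _] := special_coords.
have -> : form2 6 6 = 8 * 9 :> K by rewrite /form2; ring.
by rewrite mulf_neq0 ?natr_eq0.
Qed.

(** The cofactors are formed over k[a, b], where m is a root of both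
    polynomials.  At (2, 3) the factor T vanishes, so [elim1] is the product of
    Z - p and the cube of the quartic; as m = p there, the first cofactor is
    that cube. *)
Lemma elim_cofactors : exists Q1 Q2 : {poly K},
  [/\ elim1 J2%:P I4%:P T%:P p%:P 'X = Q1 * ('X - m%:P),
      elim2 J2%:P I4%:P I6%:P p%:P 'X = Q2 * ('X - m%:P) & coprimep Q1 Q2].
Proof.
have /factor_theorem[Q1 E1E] : root (gen_elim1 k) (gen_m k).
  have := rmorph_elim1 (horner_eval (gen_m k)) (gen_J2 k)%:P (gen_I4 k)%:P
    (gen_T k)%:P (gen_p k)%:P 'X.
  by rewrite /= !horner_evalE !hornerC hornerX elim1_root => /rootP.
have /factor_theorem[Q2 E2E] : root (gen_elim2 k) (gen_m k).
  have := rmorph_elim2 (horner_eval (gen_m k)) (gen_J2 k)%:P (gen_I4 k)%:P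
    (gen_I6 k)%:P (gen_p k)%:P 'X.
  by rewrite /= !horner_evalE !hornerC hornerX elim2_root => /rootP.
pose h : {rmorphism {poly {poly k}} -> K} := eval2 phi a b.
pose h0 : {rmorphism {poly {poly k}} -> K} := eval2 phi 2 3.
have fac (g : {rmorphism {poly {poly k}} -> K}) (E Q : {poly {poly {poly k}}}) :
    E = Q * ('X - (gen_m k)%:P) ->
    map_poly g E = map_poly g Q * ('X - (g (gen_m k))%:P).
  by move=> ->; rewrite rmorphM rmorphB /= map_polyX map_polyC.
exists (map_poly h Q1), (map_poly h Q2); split.
- by rewrite -(map_gen_elim1 phi) (fac _ _ _ E1E) eval_gen_m.
- by rewrite -(map_gen_elim2 phi) (fac _ _ _ E2E) eval_gen_m.
have [m6 p6 D23] := special_coords.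
have hn0 P : h0 P != 0 -> P != 0 by apply: contraNneq => ->; rewrite rmorph0.
have lead1 : h0 (lead_coef Q1) != 0.
  have <- : lead_coef (gen_elim1 k) = lead_coef Q1.
    by rewrite E1E lead_coefM lead_coefXsubC mulr1.
  pose c := - (36 * gen_I4 k) ^+ 3
    - 48 ^+ 3 * 27 * 6 ^+ 5 * (gen_J2 k * gen_T k).
  have cn0 : h0 c != 0.
    have -> : h0 c = - (36 * h0 (gen_I4 k)) ^+ 3
        - 48 ^+ 3 * 27 * 6 ^+ 5 * (h0 (gen_J2 k) * h0 (gen_T k)).
      by rewrite /c; ring.
    rewrite /h0 /= eval_gen_I4 eval_gen_T m6 p6 D23.
    rewrite subrr mul0r mulr0 mulr0 subr0.
    have -> : form4 6 6 23 = 720 * 11 :> K by rewrite /form4; ring.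
    by rewrite oppr_eq0 expf_neq0 ?mulf_neq0 ?natr_eq0.
  by rewrite (lead_elim1 _ (hn0 _ cn0)).
have lead2 : h0 (lead_coef Q2) != 0.
  have <- : lead_coef (gen_elim2 k) = lead_coef Q2.
    by rewrite E2E lead_coefM lead_coefXsubC mulr1.
  pose c := 3 * (36 * gen_I4 k) ^+ 2
    - 4 * 24 * 36 * 9 * gen_J2 k ^+ 2 * gen_I4 k
    + 8 * 9 * 3 * 216 * gen_J2 k * gen_I6 k.
  have cn0 : h0 c != 0.
    have -> : h0 c = 3 * (36 * h0 (gen_I4 k)) ^+ 2
        - 4 * 24 * 36 * 9 * h0 (gen_J2 k) ^+ 2 * h0 (gen_I4 k)
        + 8 * 9 * 3 * 216 * h0 (gen_J2 k) * h0 (gen_I6 k).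
      by rewrite /c; ring.
    rewrite /h0 /= eval_gen_J2 eval_gen_I4 eval_gen_I6 m6 p6 D23.
    have -> : 3 * (36 * form4 6 6 23) ^+ 2
        - 4 * 24 * 36 * 9 * form2 6 6 ^+ 2 * form4 6 6 23
        + 8 * 9 * 3 * 216 * form2 6 6 * form6 6 6 23
        = - (2 ^+ 12 * 3 ^+ 9 * 7 * 1277) :> K.
      by rewrite /form2 /form4 /form6; ring.
    by rewrite oppr_eq0 ?mulf_neq0 ?expf_neq0 ?natr_eq0.
  by rewrite (lead_elim2 _ (hn0 _ cn0)).
apply: (@coprimep_lift _ _ h h0 (eval2_inj indep_ab)) => //.
have Q1E : map_poly h0 Q1 =
    elim_A (form2 6 6)%:P (form4 6 6 23)%:P 6%:P 'X ^+ 3.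
  apply: (mulIf (negbT (polyXsubC_eq0 (6 : K)))).
  have := fac h0 _ _ E1E; rewrite [h0 (gen_m k)]eval_gen_m m6 => <-.
  rewrite (map_gen_elim1 phi) m6 p6 D23 subrr mul0r /elim1 polyC0; ring.
rewrite Q1E; apply: coprimep_expl; apply: Pdiv.ClosedField.root_coprimep => x.
rewrite rootE => A0; apply/eqP => Q20.
have {}A0 : elim_A (form2 6 6) (form4 6 6 23) 6 x = 0.
  have := rmorph_elim_A (horner_eval x) (form2 6 6)%:P (form4 6 6 23)%:P
    6%:P 'X.
  by rewrite /= !horner_evalE !hornerC hornerX (eqP A0) => <-.
have /eqP[] := special_no_common_root char_K A0.
have := rmorph_elim2 (horner_eval x) (form2 6 6)%:P (form4 6 6 23)%:P
  (form6 6 6 23)%:P 6%:P 'X.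
rewrite /= !horner_evalE !hornerC hornerX => <-.
have := fac h0 _ _ E2E; rewrite (map_gen_elim2 phi) m6 p6 D23 => ->.
by rewrite hornerM Q20 mul0r.
Qed.

(** Dividing J_4, J_6, J_10 by powers of J_2 and Z by p turns the homogeneous
    polynomials into polynomials over F, with root m / p. *)
Theorem ratio_mem_subfield (F : set K) : is_subfield F ->
  F (I4 / J2 ^+ 2) -> F (I6 / J2 ^+ 3) -> F (T / J2 ^+ 5) -> F (m / p).
Proof.
move=> sF; set al := I4 / _; set be := I6 / _; set ga := T / _.
move=> /(subfield_memP sF) Fal /(subfield_memP sF) Fbe /(subfield_memP sF) Fga.
have [Q1 [Q2 [E1E E2E co12]]] := elim_cofactors.
have pn0 := coord_p_neq0; have Jn0 := form2_neq0.
pose c1 := J2 ^+ 6 * p ^+ 13; pose c2 := J2 ^+ 4 * p ^+ 8.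
have c1n0 : c1 != 0 by rewrite mulf_neq0 ?expf_neq0.
have c2n0 : c2 != 0 by rewrite mulf_neq0 ?expf_neq0.
have I4E : I4 = al * J2 ^+ 2 by rewrite divfK ?expf_neq0.
have I6E : I6 = be * J2 ^+ 3 by rewrite divfK ?expf_neq0.
have TE : T = ga * J2 ^+ 5 by rewrite divfK ?expf_neq0.
move: (m / p) (divfK pn0 m) => z zE.
move: al be ga Fal Fbe Fga I4E I6E TE => al be ga Fal Fbe Fga I4E I6E TE.
pose pX : {poly K} := p%:P * 'X.
have lin : ('X - m%:P) \Po pX = p%:P * ('X - z%:P).
  rewrite comp_polyB comp_polyX comp_polyC mulrBr -rmorphM /=.
  by rewrite [p * _]mulrC zE.
have S1 : elim1 1 al%:P ga%:P 1 'X =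
    (c1^-1%:P * p%:P * (Q1 \Po pX)) * ('X - z%:P).
  have := congr1 (comp_poly pX) E1E; rewrite [RHS]comp_polyM lin.
  rewrite (rmorph_elim1 (comp_poly pX)) /= !comp_polyC comp_polyX I4E TE.
  rewrite !(polyCM, polyC_exp) elim1_scale => E.
  have -> : elim1 1 al%:P ga%:P 1 'X =
      c1^-1%:P * (c1%:P * elim1 1 al%:P ga%:P 1 'X).
    by rewrite mulrA -rmorphM /= mulVf // mul1r.
  by rewrite [c1%:P]polyCM !polyC_exp E; ring.
have S2 : elim2 1 al%:P be%:P 1 'X =
    (c2^-1%:P * p%:P * (Q2 \Po pX)) * ('X - z%:P).
  have := congr1 (comp_poly pX) E2E; rewrite [RHS]comp_polyM lin.
  rewrite (rmorph_elim2 (comp_poly pX)) /= !comp_polyC comp_polyX I4E I6E.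
  rewrite !(polyCM, polyC_exp) elim2_scale => E.
  have -> : elim2 1 al%:P be%:P 1 'X =
      c2^-1%:P * (c2%:P * elim2 1 al%:P be%:P 1 'X).
    by rewrite mulrA -rmorphM /= mulVf // mul1r.
  by rewrite [c2%:P]polyCM !polyC_exp E; ring.
apply: (subfield_common_root (sF := sF) _ _ S1 S2).
- rewrite /elim1 /elim_A /form2.
  by solve_mem.
- rewrite /elim2 /elim_A /form2.
  by solve_mem.
rewrite -!rmorphM /= !mul_polyC coprimepZl ?coprimepZr ?mulf_neq0 ?invr_eq0 //.
exact: coprimep_comp_poly.
Qed.

End Generic.

(** * Non-vanishing at the generic point *)

Section Nonvanishing.
Variables (k K : closedFieldType) (phi : {rmorphism k -> K}) (a b : K).
Hypothesis char_K : [pchar K] =i pred0.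
Hypothesis indep_ab : alg_independent2 phi a b.
Local Notation m := (coord_m a b).
Local Notation n := (coord_n b).
Local Notation p := (coord_p a b).
Local Notation D := (coord_D a b).

Lemma coords01 : [/\ coord_m 0 1 = - 8 :> K, coord_n 1 = - 26 :> K,
  coord_p 0 1 = 18 :> K & coord_D 0 1 = 31 :> K].
Proof. by rewrite /coord_m /coord_n /coord_p /coord_D; split; ring. Qed.

Lemma b_neq0 : b != 0.
Proof.
rewrite -(eval2Y phi a b); apply: (@eval2_neq0 _ _ phi a b indep_ab _ 0 1).
by rewrite eval2Y oner_neq0.
Qed.

Lemma coord_m_neq0 : m != 0.
Proof.
rewrite -(eval_gen_m phi); apply: (eval2_neq0 indep_ab (a0 := 0) (b0 := 1)).
by rewrite eval_gen_m; have [-> _ _ _] := coords01; rewrite oppr_eq0 natr_eq0.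
Qed.

Lemma coord_n_neq0 : n != 0.
Proof.
have ev x y : eval2 phi x y (gen_m k - gen_p k) = coord_n y.
  by rewrite (coord_nE x) -(eval_gen_m phi) -(eval_gen_p phi); ring.
rewrite -(ev a); apply: (eval2_neq0 indep_ab (a0 := 0) (b0 := 1)); rewrite ev.
by have [_ -> _ _] := coords01; rewrite oppr_eq0 natr_eq0.
Qed.

Lemma coord_D_neq0 : D != 0.
Proof.
rewrite -(eval_gen_D phi); apply: (eval2_neq0 indep_ab (a0 := 0) (b0 := 1)).
by rewrite eval_gen_D; have [_ _ _ ->] := coords01; rewrite natr_eq0.
Qed.

Lemma coord_3m4p_neq0 : 3 * m - 4 * p != 0.
Proof.
have ev x y : eval2 phi x y (3 * gen_m k - 4 * gen_p k)
    = 3 * coord_m x y - 4 * coord_p x y.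
  by rewrite -(eval_gen_m phi) -(eval_gen_p phi); ring.
rewrite -ev; apply: (eval2_neq0 indep_ab (a0 := 0) (b0 := 1)); rewrite ev.
have [-> _ -> _] := coords01.
have -> : 3 * - 8 - 4 * 18 = - 96 :> K by ring.
by rewrite oppr_eq0 natr_eq0.
Qed.

Lemma conj_p_numer_neq0 : 4 * n + 9 * p != 0.
Proof.
have ev x y : eval2 phi x y (4 * (gen_m k - gen_p k) + 9 * gen_p k)
    = 4 * coord_n y + 9 * coord_p x y.
  by rewrite (coord_nE x) -(eval_gen_m phi) -(eval_gen_p phi); ring.
rewrite -ev; apply: (eval2_neq0 indep_ab (a0 := 0) (b0 := 1)); rewrite ev.
have [_ -> -> _] := coords01.
have -> : 4 * - 26 + 9 * 18 = 58 :> K by ring.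
by rewrite natr_eq0.
Qed.

Lemma conj_diff_numer_neq0 : 8 * D * n + n * p ^+ 2 + 2 * p ^+ 3 + 108 * D != 0.
Proof.
have ev x y : eval2 phi x y (8 * gen_D k * (gen_m k - gen_p k)
     + (gen_m k - gen_p k) * gen_p k ^+ 2 + 2 * gen_p k ^+ 3 + 108 * gen_D k)
    = 8 * coord_D x y * coord_n y + coord_n y * coord_p x y ^+ 2
      + 2 * coord_p x y ^+ 3 + 108 * coord_D x y.
  rewrite (coord_nE x) -(eval_gen_m phi) -(eval_gen_p phi) -(eval_gen_D phi).
  by ring.
rewrite -ev; apply: (eval2_neq0 indep_ab (a0 := 0) (b0 := 1)); rewrite ev.
have [_ -> -> ->] := coords01.
have -> : 8 * 31 * - 26 + - 26 * 18 ^+ 2 + 2 * 18 ^+ 3 + 108 * 31 = 140 :> K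
  by ring.
by rewrite natr_eq0.
Qed.

Lemma conj_v_numer_neq0 : 4 * D * n + (n + 2 * p) * p ^+ 2 != 0.
Proof.
have ev x y : eval2 phi x y (4 * gen_D k * (gen_m k - gen_p k)
     + (gen_m k - gen_p k + 2 * gen_p k) * gen_p k ^+ 2)
    = 4 * coord_D x y * coord_n y
      + (coord_n y + 2 * coord_p x y) * coord_p x y ^+ 2.
  rewrite (coord_nE x) -(eval_gen_m phi) -(eval_gen_p phi) -(eval_gen_D phi).
  by ring.
rewrite -ev; apply: (eval2_neq0 indep_ab (a0 := 0) (b0 := 1)); rewrite ev.
have [_ -> -> ->] := coords01.
have -> : 4 * 31 * - 26 + (- 26 + 2 * 18) * 18 ^+ 2 = 16 :> K by ring.
by rewrite natr_eq0.
Qed.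

End Nonvanishing.

(** * The absolute invariants as rational functions of r_1 and r_2 *)

Section Formulas.
Variables (K : closedFieldType) (m p D r1 r2 : K).
Hypothesis char_K : [pchar K] =i pred0.
Hypotheses (mn0 : m != 0) (nn0 : m - p != 0) (Dn0 : D != 0).
Hypothesis J2n0 : form2 m p != 0.
Hypothesis r1E : r1 = m ^+ 3 / (27 * D).
Hypothesis r2E : r2 = - (m ^+ 4 / (1296 * (m - p) * D)).

(** The ratio r_2 / r_1.  In terms of it and of 1 / r_1 the invariants are
    polynomials, up to powers of r_1 and q. *)
Let slope := - (m / (48 * (m - p))).

Lemma r1_neq0 : r1 != 0.
Proof. by rewrite r1E !mulf_neq0 ?invr_eq0 ?mulf_neq0 ?expf_neq0 ?natr_eq0. Qed.

Lemma r2_slope : r2 = r1 * slope.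
Proof. by rewrite r2E r1E /slope; field; rewrite nn0 Dn0 !natr_eq0. Qed.

Lemma r1V : r1^-1 = 27 * D / m ^+ 3.
Proof. by rewrite r1E invfM invrK mulrC. Qed.

Lemma q_form2 : - 1152 * r2 ^+ 2 + 96 * r2 * r1 + r1 ^+ 2 =
  - (r1 ^+ 2 * form2 m p / (4 * (m - p) ^+ 2)).
Proof.
rewrite r2_slope /slope /form2; field.
by rewrite nn0 !natr_eq0.
Qed.

Variable q : K.
Hypothesis qE : q = - (r1 ^+ 2 * form2 m p / (4 * (m - p) ^+ 2)).

Lemma q_neq0 : q != 0.
Proof.
have xn0 := r1_neq0.
by rewrite qE oppr_eq0 !mulf_neq0 ?invr_eq0 ?mulf_neq0 ?expf_neq0 ?natr_eq0.
Qed.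

Lemma i1_formula :
  36 * (form4 m p D / form2 m p ^+ 2) = 9 / 4
           * ((13824%:R * r1 ^+ 3 * r2 ^+ 2 + 442368%:R * r1 ^+ 2 * r2 ^+ 3
               + 5308416%:R * r1 * r2 ^+ 4 + 192 * r1 ^+ 4 * r2 + r1 ^+ 5
               + 786432%:R * r1 * r2 ^+ 3 + 9437184%:R * r2 ^+ 4)
              / (r1 * q ^+ 2)) :> K.
Proof.
have xn0 := r1_neq0.
transitivity (9 / 4 * (r1 ^+ 4 / q ^+ 2
  * (13824%:R * slope ^+ 2 + 442368%:R * slope ^+ 3 + 5308416%:R * slope ^+ 4
     + 192 * slope + 1
     + r1^-1 * (786432%:R * slope ^+ 3 + 9437184%:R * slope ^+ 4)))).
  rewrite r1V qE /slope; move: J2n0; set J := form2 m p => Jn0.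
  cbv beta delta [form4]; field.
  rewrite !(oppr_eq0, mulf_eq0, expf_eq0, negb_or, natr_eq0 char_K) /=.
  by rewrite Jn0 nn0 mn0 xn0.
have qn0 := q_neq0.
by rewrite r2_slope; field; rewrite xn0 qn0 !natr_eq0.
Qed.

Lemma i2_formula :
  - 216 * ((2 * form2 m p * form4 m p D - 3 * form6 m p D) / form2 m p ^+ 3) =
  27 * (79626240%:R * r1 ^+ 4 * r2 ^+ 4 - 4076863488%:R * r1 ^+ 2 * r2 ^+ 5
    + 34560%:R * r1 ^+ 6 * r2 ^+ 2 + 12230590464%:R * r1 ^+ 2 * r2 ^+ 6
    + 32614907904%:R * r1 * r2 ^+ 6 + 14495514624%:R * r2 ^+ 6
    + 288 * r1 ^+ 7 * r2 + 2211840%:R * r1 ^+ 5 * r2 ^+ 3 + r1 ^+ 8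
    - 212336640%:R * r1 ^+ 3 * r2 ^+ 4 + 1528823808%:R * r1 ^+ 3 * r2 ^+ 5
    - 2359296%:R * r1 ^+ 4 * r2 ^+ 3) / (8 * r1 ^+ 2 * q ^+ 3) :> K.
Proof.
have xn0 := r1_neq0.
transitivity (27 / 8 * (r1 ^+ 6 / q ^+ 3
  * (79626240%:R * slope ^+ 4 + 34560%:R * slope ^+ 2
     + 12230590464%:R * slope ^+ 6 + 288 * slope + 2211840%:R * slope ^+ 3 + 1
     + 1528823808%:R * slope ^+ 5
     + r1^-1 * (- 4076863488%:R * slope ^+ 5 + 32614907904%:R * slope ^+ 6
                - 212336640%:R * slope ^+ 4 - 2359296%:R * slope ^+ 3)
     + r1^-1 ^+ 2 * 14495514624%:R * slope ^+ 6))).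
  transitivity (- 216 * (((12 * m ^+ 2 - 8 * p ^+ 2) * form4 m p D
                          - 3 * form6 m p D) / form2 m p ^+ 3)).
    by congr (_ * ((_ * _ - _) / _)); rewrite /form2; ring.
  rewrite r1V qE /slope; move: J2n0; set J := form2 m p => Jn0.
  cbv beta delta [form4 form6]; field.
  rewrite !(oppr_eq0, mulf_eq0, expf_eq0, negb_or, natr_eq0 char_K) /=.
  by rewrite Jn0 nn0 mn0 xn0.
have qn0 := q_neq0.
by rewrite r2_slope; field; rewrite xn0 qn0 !natr_eq0.
Qed.

Lemma i3_formula :
  - 7776%:R * ((m - p) * D ^+ 3 / form2 m p ^+ 5) =
  - 521838526464%:R * (r2 ^+ 9 / (r1 ^+ 2 * q ^+ 5)) :> K.
Proof.
have xn0 := r1_neq0.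
transitivity (- 521838526464%:R
  * (r1 ^+ 10 * r1^-1 ^+ 3 * slope ^+ 9 / q ^+ 5)).
  rewrite r1V qE /slope; move: J2n0; set J := form2 m p => Jn0; field.
  rewrite !(oppr_eq0, mulf_eq0, expf_eq0, negb_or, natr_eq0 char_K) /=.
  by rewrite Jn0 nn0 mn0 xn0.
have qn0 := q_neq0.
by rewrite r2_slope; field; rewrite xn0 qn0.
Qed.

End Formulas.

Section AbsoluteInvariants.
Variables (K : closedFieldType) (a b : K).
Hypothesis char_K : [pchar K] =i pred0.
Local Notation m := (coord_m a b).
Local Notation p := (coord_p a b).
Local Notation D := (coord_D a b).
Hypothesis J2n0 : form2 m p != 0.
Let f : {poly K} :=
  ('X^3 + a *: 'X^2 + b *: 'X + 1)
    * (4 *: 'X^3 + b ^+ 2 *: 'X^2 + (2 * b) *: 'X + 1).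

Lemma absolute_i1_curve :
  absolute_i1 f = 36 * (form4 m p D / form2 m p ^+ 2) :> K.
Proof.
by rewrite /absolute_i1 (curve_J2 char_K) -(curve_J4 char_K); field.
Qed.

Lemma absolute_i2_curve : absolute_i2 f =
  - 216 * ((2 * form2 m p * form4 m p D - 3 * form6 m p D)
           / form2 m p ^+ 3) :> K.
Proof.
rewrite /absolute_i2 (curve_J2 char_K) -(curve_J4 char_K) -(curve_J6 char_K).
by field.
Qed.

Lemma absolute_i3_curve : absolute_i3 f =
  - 7776%:R * ((m - p) * D ^+ 3 / form2 m p ^+ 5) :> K.
Proof.
rewrite /absolute_i3 (curve_J2 char_K) (curve_J10 char_K) (coord_nE a b).
by field.
Qed.

End AbsoluteInvariants.

(** * The field generated by n / p and D / p^3 *)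

Section Slopes.
Variables (K : fieldType) (F : set K) (sF : is_subfield F).
Variables m p D : K.
Hypothesis char_K : [pchar K] =i pred0.
Hypotheses (mn0 : m != 0) (pn0 : p != 0) (nn0 : m - p != 0) (Dn0 : D != 0).
Hypothesis J2n0 : form2 m p != 0.
Local Notation z := (m / p).
Local Notation c := ((m - p) / p).
Local Notation y := (D / p ^+ 3).
Local Notation r1 := (m ^+ 3 / (27 * D)).
Local Notation r2 := (- (m ^+ 4 / (1296 * (m - p) * D))).
Local Notation al := (form4 m p D / form2 m p ^+ 2).
Local Notation be := (form6 m p D / form2 m p ^+ 3).
Local Notation ga := ((m - p) * D ^+ 3 / form2 m p ^+ 5).

Let nz n : (n != 0)%N -> n%:R != 0 :> K.
Proof. by move/pcharf0P: char_K => ->. Qed.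

Local Ltac solve_nonzero :=
  rewrite ?(oppr_eq0, mulf_eq0, expf_eq0, negb_or) /=;
  rewrite ?nz ?mn0 ?pn0 ?nn0 ?Dn0 //.

Lemma slopes_of_r : F r1 -> F r2 -> F c /\ F y.
Proof.
move=> /(subfield_memP sF) Fr1 /(subfield_memP sF) Fr2.
have cE : c = - (1 + 48 * r2 / r1)^-1.
  have -> : 1 + 48 * r2 / r1 = - (p / (m - p)).
    by field; solve_nonzero.
  by field; solve_nonzero.
have yE : y = (c + 1) ^+ 3 / (27 * r1).
  by field; solve_nonzero.
have Fc : c \in subfield_mem sF.
  by rewrite cE rpredN rpredV; solve_mem.
split; apply/(subfield_memP sF) => //.
by rewrite yE; solve_mem.
Qed.

Lemma r_of_slopes : F c -> F y -> F r1 /\ F r2.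
Proof.
move=> /(subfield_memP sF) Fc /(subfield_memP sF) Fy.
have r1E : r1 = (c + 1) ^+ 3 / (27 * y).
  by field; solve_nonzero.
have r2E : r2 = - ((c + 1) ^+ 4 / (1296 * c * y)).
  by field; solve_nonzero.
split; apply/(subfield_memP sF).
  by rewrite r1E; solve_mem.
by rewrite r2E; solve_mem.
Qed.

Lemma invariants_of_slopes : F c -> F y -> [/\ F al, F be & F ga].
Proof.
move=> /(subfield_memP sF) Fc /(subfield_memP sF) Fy.
have zE : z = c + 1 by field.
have Fz : z \in subfield_mem sF by rewrite zE rpredD ?rpred1.
have J2E : form2 m p = p ^+ 2 * form2 z 1 by rewrite /form2; field.
have I4E : form4 m p D = p ^+ 4 * form4 z 1 y by rewrite /form4; field.
have I6E : form6 m p D = p ^+ 6 * form6 z 1 y by rewrite /form6; field.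
have Jn0 : form2 z 1 != 0.
  by move: J2n0; rewrite J2E mulf_eq0 negb_or => /andP[].
have alE : al = form4 z 1 y / form2 z 1 ^+ 2.
  by rewrite I4E J2E; field; solve_nonzero; rewrite ?Jn0.
have beE : be = form6 z 1 y / form2 z 1 ^+ 3.
  by rewrite I6E J2E; field; solve_nonzero; rewrite ?Jn0.
have gaE : ga = c * y ^+ 3 / form2 z 1 ^+ 5.
  by rewrite J2E; field; solve_nonzero; rewrite ?Jn0.
split; apply/(subfield_memP sF).
- rewrite alE /form4 /form2; solve_mem.
- rewrite beE /form6 /form2; solve_mem.
rewrite gaE /form2; solve_mem.
Qed.

(** Knowing z = m / p, the value of J_4 / J_2^2 is linear in D / p^3, with
    leading coefficient proportional to 3z - 4. *)
Lemma slopes_of_invariants : 3 * m - 4 * p != 0 -> F z -> F al -> F c /\ F y.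
Proof.
move=> en0 /(subfield_memP sF) Fz /(subfield_memP sF) Fal.
have cE : c = z - 1 by field.
have J2E : form2 m p = p ^+ 2 * form2 z 1 by rewrite /form2; field.
have yE : y = (1 - al * form2 z 1 ^+ 2) / (48 * (3 * z - 4)).
  have -> : al * form2 z 1 ^+ 2 = form4 m p D / p ^+ 4.
    rewrite J2E; field; rewrite pn0 /=.
    by move: J2n0; rewrite J2E mulf_eq0 negb_or => /andP[].
  have en0' : 3 * m + -4 * p != 0 by rewrite mulNr.
  by rewrite /form4; field; rewrite ?nz ?pn0 ?en0'.
split; apply/(subfield_memP sF); first by rewrite cE rpredB ?rpred1.
rewrite yE /form2; solve_mem.
Qed.

End Slopes.

(** * The quadratic equation for p and its conjugate root *)

Section RationalFunctions.
Variable R : comUnitRingType.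
Definition r_denominator (u v : R) :=
  4 * v ^+ 2 - 18 * u * v + 27 * v - u ^+ 2 * v + 4 * u ^+ 3.
Definition r1_fun (u v : R) :=
  v * (v - 9 - 2 * u) ^+ 3 / (27 * r_denominator u v).
Definition r2_fun (u v : R) :=
  - (v * (v - 9 - 2 * u) ^+ 4 / (1296 * (v - 27) * r_denominator u v)).
End RationalFunctions.

Lemma r_fun_mem (K : fieldType) (F : set K) (sF : is_subfield F) (u v : K) :
  F u -> F v -> F (r1_fun u v) /\ F (r2_fun u v).
Proof.
move=> /(subfield_memP sF) Fu /(subfield_memP sF) Fv.
split; apply/(subfield_memP sF); rewrite /r1_fun /r2_fun /r_denominator.
  by solve_mem.
by solve_mem.
Qed.

(** After division by p^2, this is the quadratic equation of p over k(c, y). *)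
Lemma coord_relation (R : comNzRingType) (a b : R) :
  let n := coord_n b in let p := coord_p a b in let D := coord_D a b in
  4 * D * n + n * p ^+ 2 + 2 * p ^+ 3 + 108 * D = (4 * n + 9 * p) ^+ 2.
Proof. by rewrite /coord_n /coord_p /coord_D /=; ring. Qed.

(** The quadratic equation is what d = y P^3 v becomes after division by P^2.
    The values of r_1 and r_2 only involve c and y, so they are the same for
    both roots P. *)
Lemma r_of_slope (K : fieldType) (c y P : K) :
  2 != 0 :> K -> 3 != 0 :> K -> c != 0 -> y != 0 -> P != 0 ->
  27 + c * P != 0 ->
  4 * y * c * P ^+ 2 + (c + 2 + 108 * y) * P = (4 * c + 9) ^+ 2 ->
  let u := 9 - P / 2 in let v := 27 + c * P in
  let d := 4 * v ^+ 2 - 18 * u * v + 27 * v - u ^+ 2 * v + 4 * u ^+ 3 in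
  [/\ d != 0, v * (v - 9 - 2 * u) ^+ 3 / (27 * d) = (c + 1) ^+ 3 / (27 * y) &
   - (v * (v - 9 - 2 * u) ^+ 4 / (1296 * (v - 27) * d)) =
   - ((c + 1) ^+ 4 / (1296 * c * y))].
Proof.
move=> n2 n3 cn0 yn0 Pn0 vn0 rel u v d.
have dE : d = y * P ^+ 3 * v.
  apply/eqP; rewrite -subr_eq0; apply/eqP.
  transitivity (P ^+ 2 / 4 * ((4 * c + 9) ^+ 2
    - (4 * y * c * P ^+ 2 + (c + 2 + 108 * y) * P))).
    by rewrite /d /u /v; field; rewrite (_ : 4 = 2 * 2) ?mulf_neq0 //; ring.
  by rewrite rel subrr mulr0.
have mE : v - 9 - 2 * u = (c + 1) * P by rewrite /u /v; field.
have n27 : 27 != 0 :> K by rewrite (_ : 27 = 3 ^+ 3) ?expf_neq0 //; ring.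
have n1296 : 1296 != 0 :> K.
  by rewrite (_ : 1296 = (2 * 3) ^+ 4) ?expf_neq0 ?mulf_neq0 //; ring.
rewrite dE mE (_ : v - 27 = c * P); last by rewrite /v; ring.
split; first by rewrite !mulf_neq0 ?expf_neq0.
  by field; rewrite ?n27 ?yn0 ?Pn0 ?vn0.
by field; rewrite ?n1296 ?yn0 ?Pn0 ?vn0 ?cn0.
Qed.

Section ConjugateSlope.
Variables (K : fieldType) (c y P : K).
Hypotheses (n2 : 2 != 0 :> K) (cn0 : c != 0) (yn0 : y != 0) (Pn0 : P != 0).
Hypothesis rel :
  4 * y * c * P ^+ 2 + (c + 2 + 108 * y) * P = (4 * c + 9) ^+ 2.
(* The other root, from the product of the two roots. *)
Local Notation P' := (- ((4 * c + 9) ^+ 2 / (4 * y * c * P))).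

Let n4 : 4 != 0 :> K.
Proof. by rewrite (_ : 4 = 2 * 2) ?mulf_neq0 //; ring. Qed.

Lemma conj_relation :
  4 * y * c * P' ^+ 2 + (c + 2 + 108 * y) * P' = (4 * c + 9) ^+ 2.
Proof.
apply/eqP; rewrite -subr_eq0; apply/eqP.
transitivity ((4 * c + 9) ^+ 2 / (4 * y * c * P ^+ 2) * ((4 * c + 9) ^+ 2
  - (4 * y * c * P ^+ 2 + (c + 2 + 108 * y) * P))).
  by field; rewrite cn0 yn0 Pn0 n4.
by rewrite rel subrr mulr0.
Qed.

Lemma conj_v : 27 + c * P' = - ((4 * y * c * P + (c + 2)) / (4 * y)).
Proof. by rewrite -rel; field; rewrite cn0 yn0 Pn0 n4. Qed.

Lemma conj_fixed : P = P' -> 8 * y * c * P + (c + 2 + 108 * y) = 0.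
Proof.
move=> PP; apply: (mulIf Pn0); rewrite mul0r.
transitivity (4 * y * c * P * (P - P')
  + (4 * y * c * P ^+ 2 + (c + 2 + 108 * y) * P - (4 * c + 9) ^+ 2)).
  by field; rewrite cn0 yn0 Pn0 n4.
by rewrite -PP rel !subrr mulr0 addr0.
Qed.

Lemma conj_discriminant : (8 * y * c * P + (c + 2 + 108 * y)) ^+ 2 =
  16 * y * c * (4 * c + 9) ^+ 2 + (c + 2 + 108 * y) ^+ 2.
Proof. by rewrite -rel; ring. Qed.

End ConjugateSlope.

Section Conjugation.
Variables (k K : closedFieldType) (phi : {rmorphism k -> K}) (a b : K).
Hypothesis char_K : [pchar K] =i pred0.
Hypothesis indep_ab : alg_independent2 phi a b.
Local Notation m := (coord_m a b).
Local Notation n := (coord_n b).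
Local Notation p := (coord_p a b).
Local Notation D := (coord_D a b).
Local Notation c := (n / p).
Local Notation y := (D / p ^+ 3).
Local Notation u := (a * b).
Local Notation v := (b ^+ 3).
(* Up to a factor in k(c, y), the difference of the two roots. *)
Local Notation w := (8 * y * c * p + (c + 2 + 108 * y)).
Local Notation p' := (- ((4 * c + 9) ^+ 2 / (4 * y * c * p))).

Let nz N : (N != 0)%N -> N%:R != 0 :> K.
Proof. by rewrite natr_eq0. Qed.

Let pn0 : p != 0 := coord_p_neq0 char_K indep_ab.
Let nn0 : n != 0 := coord_n_neq0 char_K indep_ab.
Let Dn0 : D != 0 := coord_D_neq0 char_K indep_ab.

Lemma slope_relation :
  4 * y * c * p ^+ 2 + (c + 2 + 108 * y) * p = (4 * c + 9) ^+ 2 :> K.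
Proof.
have rel := coord_relation a b.
transitivity ((4 * n + 9 * p) ^+ 2 / p ^+ 2); last by field.
by rewrite -rel; field.
Qed.

Lemma w_neq0 : w != 0.
Proof.
have -> : w = (8 * D * n + n * p ^+ 2 + 2 * p ^+ 3 + 108 * D) / p ^+ 3 by field.
by rewrite mulf_neq0 ?invr_eq0 ?expf_neq0 //
  (conj_diff_numer_neq0 char_K indep_ab).
Qed.

Let cn0 : c != 0. Proof. by rewrite mulf_neq0 ?invr_eq0. Qed.
Let yn0 : y != 0. Proof. by rewrite mulf_neq0 ?invr_eq0 ?expf_neq0. Qed.

Lemma conj_v_neq0 : 27 + c * p' != 0.
Proof.
rewrite conj_v ?nz //; last exact: slope_relation.
have -> : 4 * y * c * p + (c + 2) =
    (4 * D * n + (n + 2 * p) * p ^+ 2) / p ^+ 3 by field.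
by rewrite oppr_eq0 !mulf_neq0 ?invr_eq0 ?mulf_neq0 ?invr_eq0 ?expf_neq0 ?nz
  ?(conj_v_numer_neq0 char_K indep_ab).
Qed.

Lemma conj_p_neq0 : p' != 0.
Proof.
have -> : 4 * c + 9 = (4 * n + 9 * p) / p by field.
by rewrite oppr_eq0 !(mulf_eq0, invr_eq0, expf_eq0) /= (negPf pn0) ?nz
  (negPf (conj_p_numer_neq0 char_K indep_ab)) (negPf nn0) (negPf Dn0)
  (negPf (nz (isT : (4 != 0)%N))).
Qed.

Let r1 := r1_fun u v.
Let r2 := r2_fun u v.

Lemma cube_root (x : K) : exists t, t ^+ 3 = x.
Proof.
have /closed_rootP[t] : size ('X^3 - x%:P : {poly K}) != 1%N.
  by rewrite size_XnsubC.
by rewrite rootE !hornerE subr_eq0 => /eqP <-; exists t; rewrite ?hornerXn.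
Qed.

(** The conjugate point (u', v') is a value of (ab, b^3), as K has cube roots;
    so the conjugation is the change from the evaluation at (a, b) to the one
    at some (a', b'). *)
Lemma p_not_mem : ~ adjoin_field phi [set r1; r2] p.
Proof.
pose u' := 9 - p' / 2; pose v' := 27 + c * p'.
have v'n0 : v' != 0 := conj_v_neq0.
have [b' b'E] := cube_root v'.
have b'n0 : b' != 0 by move: v'n0; rewrite -b'E expf_eq0.
pose a' := u' / b'; have a'b' : a' * b' = u' by rewrite divfK.
pose h : {rmorphism {poly {poly k}} -> K} := eval2 phi a b.
pose h' : {rmorphism {poly {poly k}} -> K} := eval2 phi a' b'.
pose uR : {poly {poly k}} := 'X * 'X%:P.
pose vR : {poly {poly k}} := 'X%:P ^+ 3.
have hX : (h 'X = a) * (h 'X%:P = b) by rewrite /h /= eval2X eval2Y.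
have hX' : (h' 'X = a') * (h' 'X%:P = b') by rewrite /h' /= eval2X eval2Y.
have huv : (h uR = u) * (h vR = v) by rewrite /uR /vR rmorphM rmorphXn !hX.
have huv' : (h' uR = u') * (h' vR = v').
  by rewrite /uR /vR rmorphM rmorphXn !hX' a'b' b'E.
have hp : h (18 - 2 * uR) = p by rewrite rmorphB rmorphM !rmorph_nat huv.
have half (x : K) : 18 - 2 * (9 - x / 2) = x by field; rewrite nz.
have hp' : h' (18 - 2 * uR) = p'.
  by rewrite rmorphB rmorphM !rmorph_nat huv' /u' half.
have h_inj : injective h by apply: eval2_inj.
have n2 : 2 != 0 :> K by rewrite nz.
have n3 : 3 != 0 :> K by rewrite nz.
have uE : u = 9 - p / 2 by rewrite /coord_p; field; rewrite n2.
have vE : v = 27 + c * p by rewrite divfK // /coord_n; ring.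
have vn0 : 27 + c * p != 0.
  by rewrite -vE expf_neq0 // (b_neq0 indep_ab).
have [d0 r1E r2E] := r_of_slope n2 n3 cn0 yn0 pn0 vn0 slope_relation.
have [d0' r1E' r2E'] := r_of_slope n2 n3 cn0 yn0 conj_p_neq0 v'n0
  (conj_relation n2 cn0 yn0 pn0 slope_relation).
rewrite -uE -vE in d0 r1E r2E.
pose dR := 4 * vR ^+ 2 - 18 * uR * vR + 27 * vR - uR ^+ 2 * vR + 4 * uR ^+ 3.
have hd (g : {rmorphism {poly {poly k}} -> K}) :
    g dR = r_denominator (g uR) (g vR) by rewrite /dR /r_denominator; ring.
have Ak : forall e, agreement_field h h' (phi e).
  move=> e; exists e%:P%:P, 1.
  by rewrite !rmorph1 !divr1 oner_neq0 /h /h' /= !eval2C.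
have Ar1 : agreement_field h h' r1.
  exists (vR * (vR - 9 - 2 * uR) ^+ 3), (27 * dR).
  have num (g : {rmorphism {poly {poly k}} -> K}) :
      g (vR * (vR - 9 - 2 * uR) ^+ 3) =
      g vR * (g vR - 9 - 2 * g uR) ^+ 3 by ring.
  have den (g : {rmorphism {poly {poly k}} -> K}) : g (27 * dR) = 27 * g dR.
    by ring.
  rewrite !num !den !hd !huv !huv'; have n27 : 27 != 0 :> K by rewrite nz.
  split; [by rewrite mulf_neq0 | by rewrite mulf_neq0 | exact: erefl |].
  exact: etrans r1E (esym r1E').
have Ar2 : agreement_field h h' r2.
  have n1296 : 1296 != 0 :> K by rewrite nz.
  have v27 : v - 27 != 0 by rewrite vE addrC addKr mulf_neq0.
  have v27' : v' - 27 != 0.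
    by rewrite /v' addrC addKr mulf_neq0 // conj_p_neq0.
  exists (- (vR * (vR - 9 - 2 * uR) ^+ 4)), (1296 * (vR - 27) * dR).
  have num (g : {rmorphism {poly {poly k}} -> K}) :
      g (- (vR * (vR - 9 - 2 * uR) ^+ 4)) =
      - (g vR * (g vR - 9 - 2 * g uR) ^+ 4) by ring.
  have den (g : {rmorphism {poly {poly k}} -> K}) :
      g (1296 * (vR - 27) * dR) = 1296 * (g vR - 27) * g dR by ring.
  rewrite !num !den !hd !huv !huv' !mulNr.
  split; [by rewrite !mulf_neq0 | by rewrite !mulf_neq0 | exact: erefl |].
  exact: etrans r2E (esym r2E').
have sA := agreement_subfield h h'.
have Asub : adjoin_field phi [set r1; r2] `<=` agreement_field h h'.
  by apply: adjoin_min => // x [->|->].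
move=> /Asub; rewrite -{1}hp => /(agreement_eq h_inj).
rewrite hp hp' => /(conj_fixed n2 cn0 yn0 pn0 slope_relation) w0.
by have := w_neq0; rewrite w0 eqxx.
Qed.

End Conjugation.

(** * The theorem *)

Theorem lemma8 (k : closedFieldType) (char_k : [pchar k] =i pred0)
    (K : closedFieldType) (phi : {rmorphism k -> K}) (a b : K)
    (indep_ab : alg_independent2 phi a b) :
  let u := a * b in
  let v := b ^+ 3 in
  let f : {poly K} :=
    ('X^3 + a *: 'X^2 + b *: 'X + 1)
    * (4 *: 'X^3 + b ^+ 2 *: 'X^2 + (2 * b) *: 'X + 1) in
  let i1 := absolute_i1 f in
  let i2 := absolute_i2 f in
  let i3 := absolute_i3 f in
  let d := 4 * v ^+ 2 - 18 * u * v + 27 * v - u ^+ 2 * v + 4 * u ^+ 3 in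
  let r1 := v * (v - 9 - 2 * u) ^+ 3 / (27 * d) in
  let r2 := - (v * (v - 9 - 2 * u) ^+ 4 / (1296 * (v - 27) * d)) in
  let q := - 1152 * r2 ^+ 2 + 96 * r2 * r1 + r1 ^+ 2 in
  let P :=
    79626240%:R * r1 ^+ 4 * r2 ^+ 4 - 4076863488%:R * r1 ^+ 2 * r2 ^+ 5
    + 34560%:R * r1 ^+ 6 * r2 ^+ 2 + 12230590464%:R * r1 ^+ 2 * r2 ^+ 6
    + 32614907904%:R * r1 * r2 ^+ 6 + 14495514624%:R * r2 ^+ 6
    + 288 * r1 ^+ 7 * r2 + 2211840%:R * r1 ^+ 5 * r2 ^+ 3 + r1 ^+ 8
    - 212336640%:R * r1 ^+ 3 * r2 ^+ 4 + 1528823808%:R * r1 ^+ 3 * r2 ^+ 5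
    - 2359296%:R * r1 ^+ 4 * r2 ^+ 3 in
  let k_uv := adjoin_field phi [set u; v] in
  let k_i := adjoin_field phi [set i1; i2; i3] in
  let k_r := adjoin_field phi [set r1; r2] in
  (* all the quotients involved have a nonzero denominator *)
  [/\ igusa_clebsch_J2 f != 0, d != 0, v - 27 != 0, r1 != 0 & q != 0] /\
  [/\ k_i `<=` k_uv, k_r `<=` k_uv, k_i = k_r & has_degree k_i k_uv 2] /\
  [/\ i1 = 9 / 4
           * ((13824%:R * r1 ^+ 3 * r2 ^+ 2 + 442368%:R * r1 ^+ 2 * r2 ^+ 3
               + 5308416%:R * r1 * r2 ^+ 4 + 192 * r1 ^+ 4 * r2 + r1 ^+ 5
               + 786432%:R * r1 * r2 ^+ 3 + 9437184%:R * r2 ^+ 4)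
              / (r1 * q ^+ 2)),
      i2 = 27 * P / (8 * r1 ^+ 2 * q ^+ 3) &
      i3 = - 521838526464%:R * (r2 ^+ 9 / (r1 ^+ 2 * q ^+ 5))].
Proof.
move=> u v f i1 i2 i3 d r1 r2 q P k_uv k_i k_r.
have char_K : [pchar K] =i pred0.
  by move=> x; rewrite (fmorph_pchar phi) char_k.
pose m := coord_m a b; pose n := coord_n b; pose p := coord_p a b.
pose D := coord_D a b; pose c := n / p; pose y := D / p ^+ 3.
have bn0 : b != 0 := b_neq0 indep_ab.
have vn0 : v != 0 by rewrite expf_neq0.
have mn0 : m != 0 := coord_m_neq0 char_K indep_ab.
have nn0 : n != 0 := coord_n_neq0 char_K indep_ab.
have pn0 : p != 0 := coord_p_neq0 char_K indep_ab.
have Dn0 : D != 0 := coord_D_neq0 char_K indep_ab.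
have J2n0 : form2 m p != 0 := form2_neq0 char_K indep_ab.
have nE : n = m - p := coord_nE a b.
have mpn0 : m - p != 0 by rewrite -nE.
have n27 : 27 != 0 :> K by rewrite (natr_eq0 char_K).
have n1296 : 1296 != 0 :> K by rewrite (natr_eq0 char_K).
have dE : d = v * D by rewrite /d /D /coord_D /v /u; ring.
have mE : v - 9 - 2 * u = m by [].
have vnE : v - 27 = n by [].
have r1E : r1 = m ^+ 3 / (27 * D).
  by rewrite /r1 mE dE; field; rewrite n27 Dn0 vn0.
have r2E : r2 = - (m ^+ 4 / (1296 * (m - p) * D)).
  by rewrite /r2 mE dE -nE vnE; field; rewrite n1296 nn0 Dn0 vn0.
have qE : q = - (r1 ^+ 2 * form2 m p / (4 * (m - p) ^+ 2)).
  exact: (q_form2 char_K mpn0 Dn0 r1E r2E).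
have r1n0 : r1 != 0 := r1_neq0 char_K mn0 Dn0 r1E.
pose al := form4 m p D / form2 m p ^+ 2.
pose be := form6 m p D / form2 m p ^+ 3.
pose ga := (m - p) * D ^+ 3 / form2 m p ^+ 5.
have i1E : i1 = 36 * al := absolute_i1_curve char_K J2n0.
have i2E : i2 = - 216 * (2 * al - 3 * be).
  rewrite /i2 (absolute_i2_curve char_K J2n0) /al /be -/m -/p -/D.
  by move: J2n0; set J := form2 m p => J2n0; field; rewrite J2n0.
have i3E : i3 = - 7776%:R * ga := absolute_i3_curve char_K J2n0.
split; [|split].
- split.
  + by rewrite (curve_J2 char_K).
  + by rewrite dE mulf_neq0.
  + by rewrite vnE.
  + exact: r1n0.
  + exact: (q_neq0 char_K mn0 mpn0 Dn0 J2n0 r1E qE).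
- have sr : is_subfield k_r := adjoin_subfield phi _.
  have si : is_subfield k_i := adjoin_subfield phi _.
  have su : is_subfield k_uv := adjoin_subfield phi _.
  have kr1 : k_r r1 by apply: sub_adjoin; left.
  have kr2 : k_r r2 by apply: sub_adjoin; right.
  have [kc ky] : k_r c /\ k_r y.
    rewrite /c nE; apply: (slopes_of_r sr char_K mn0 pn0 mpn0 Dn0).
      by rewrite -r1E.
    by rewrite -r2E.
  have kir : k_i = k_r.
    rewrite eqEsubset; split; apply: adjoin_min => //; try exact: adjoin_scalar.
      have [kal kbe kga] : [/\ k_r al, k_r be & k_r ga].
        by apply: (invariants_of_slopes sr pn0 J2n0); rewrite -?nE.
      have {}kal := introT (subfield_memP sr al) kal.
      have {}kbe := introT (subfield_memP sr be) kbe.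
      have {}kga := introT (subfield_memP sr ga) kga.
      move=> _ [[->|->]|->]; apply/(subfield_memP sr).
      + by rewrite i1E; solve_mem.
      + by rewrite i2E; solve_mem.
      + by rewrite i3E; solve_mem.
    have /(subfield_memP si) ki1 : k_i i1 by apply: sub_adjoin; left; left.
    have /(subfield_memP si) ki2 : k_i i2 by apply: sub_adjoin; left; right.
    have /(subfield_memP si) ki3 : k_i i3 by apply: sub_adjoin; right.
    have alE : al = i1 / 36 by rewrite i1E; field; rewrite !natr_eq0.
    have kal : al \in subfield_mem si by rewrite alE; solve_mem.
    have beE : be = (2 * al + i2 / 216) / 3.
      by rewrite i2E; field; rewrite !natr_eq0.
    have gaE : ga = - i3 / 7776%:R.
      by rewrite i3E; field; rewrite !natr_eq0.
    have kbe : be \in subfield_mem si by rewrite beE; solve_mem.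
    have kga : ga \in subfield_mem si by rewrite gaE; solve_mem.
    have kz : k_i (m / p).
      by apply: (ratio_mem_subfield char_K indep_ab si);
         apply/(subfield_memP si).
    have [kic kiy] : k_i ((m - p) / p) /\ k_i y.
      apply: (slopes_of_invariants si char_K pn0 J2n0 _ kz).
        exact: (coord_3m4p_neq0 char_K indep_ab).
      exact/(subfield_memP si).
    have [kir1 kir2] := r_of_slopes si char_K pn0 mpn0 Dn0 kic kiy.
    by move=> _ [->|->]; rewrite ?r1E ?r2E.
  have ku : k_uv u by apply: sub_adjoin; left.
  have kv : k_uv v by apply: sub_adjoin; right.
  have kur : k_r `<=` k_uv.
    have [kur1 kur2] := r_fun_mem su ku kv.
    by apply: adjoin_min => // [e|_ [->|->]] //; exact: adjoin_scalar.
  split=> //; rewrite kir //.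
  have rel : 4 * y * c * p ^+ 2 + (c + 2 + 108 * y) * p = (4 * c + 9) ^+ 2.
    exact: slope_relation char_K indep_ab.
  have n2 : 2 != 0 :> K by rewrite natr_eq0.
  have n8 : 8 != 0 :> K by rewrite natr_eq0.
  have cn0 : c != 0 by rewrite mulf_neq0 ?invr_eq0.
  have yn0 : y != 0 by rewrite mulf_neq0 ?invr_eq0 ?expf_neq0.
  pose B := c + 2 + 108 * y; pose w := 8 * y * c * p + B.
  have pE : p = (w - B) / (8 * y * c).
    by rewrite /w; field; rewrite n8 yn0 cn0.
  have /(subfield_memP sr) rc := kc; have /(subfield_memP sr) ry := ky.
  have rB : B \in subfield_mem sr by rewrite /B; solve_mem.
  have kw2 : k_r (w ^+ 2).
    apply/(subfield_memP sr); rewrite (conj_discriminant rel) -/B.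
    by move: (B) rB => B' rB'; solve_mem.
  have kw : ~ k_r w.
    move=> /(subfield_memP sr) rw; apply: (p_not_mem char_K indep_ab).
    apply/(subfield_memP sr); rewrite -/p pE.
    by move: (w) (B) rw rB => w' B' rw' rB'; solve_mem.
  have kuw : k_uv w.
    apply/(subfield_memP su); rewrite /w /B.
    have /(subfield_memP su) uc : k_uv c := kur _ kc.
    have /(subfield_memP su) uy : k_uv y := kur _ ky.
    have ru : u \in subfield_mem su by apply/(subfield_memP su).
    have rp : p \in subfield_mem su by rewrite /p /coord_p -/u; solve_mem.
    by solve_mem.
  apply: (has_degree2 sr kw su kur kuw).
  apply: adjoin_min (quadratic_span_subfield sr kw2 kw) _ _.
    move=> e; exists (phi e), 0; rewrite mul0r addr0; split=> //.
      exact: adjoin_scalar.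
    by apply/(subfield_memP sr); rewrite rpred0.
  have uE : u = 9 + B / (16 * y * c) + (- (1 / (16 * y * c))) * w.
    have -> : u = 9 - p / 2 by rewrite /p /coord_p -/u; field; rewrite n2.
    rewrite pE; field; rewrite cn0 yn0 !natr_eq0 //.
  have vE : v = 27 - B / (8 * y) + 1 / (8 * y) * w.
    have -> : v = 27 + c * p by rewrite /c divfK // /n /coord_n -/v; ring.
    rewrite pE; field; rewrite cn0 yn0 !natr_eq0 //.
  move=> _ [->|->].
    exists (9 + B / (16 * y * c)), (- (1 / (16 * y * c))); split=> //.
      by apply/(subfield_memP sr); move: (B) rB => B' rB'; solve_mem.
    by apply/(subfield_memP sr); solve_mem.
  exists (27 - B / (8 * y)), (1 / (8 * y)); split=> //.
    by apply/(subfield_memP sr); move: (B) rB => B' rB'; solve_mem.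
  by apply/(subfield_memP sr); solve_mem.
have i2E' := absolute_i2_curve char_K J2n0.
split.
- exact: (etrans i1E (i1_formula char_K mn0 mpn0 Dn0 J2n0 r1E r2E qE)).
- exact: (etrans i2E' (i2_formula char_K mn0 mpn0 Dn0 J2n0 r1E r2E qE)).
- exact: (etrans i3E (i3_formula char_K mn0 mpn0 Dn0 J2n0 r1E r2E qE)).
Qed.
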